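(* Let $C$ be any coalgebra over a field $k$ and let $S$ be a simple right $C$-comodule. Let $E(S)$ be the injective envelope of $S$ as a right $C$-comodule. Then the graded comodule $\operatorname{gr} E(S)$ is isomorphic, as a right $\operatorname{gr} C$-comodule, to the injective envelope over $\operatorname{gr} C$ of the simple right $\operatorname{gr} C$-comodule $S$.
   Context: $k$ is a field. For a coalgebra $C$ with coradical filtration $C_0\subseteq C_1\subseteq\cdots$ (with $C_0$ the sum of simple subcoalgebras, $C_{n+1}=\Delta^{-1}(C_n\otimes C+C\otimes C_0)$, $C_{-1}=0$), $\operatorname{gr} C=\bigoplus_{i\ge0}C_i/C_{i-1}$ is the associated graded coalgebra with comultiplication induced by $\Delta$ (using $\Delta(C_n)\subseteq\sum_{i}C_i\otimes C_{n-i}$). For a right $C$-comodule $(M,\rho)$, the Loewy series $M_0\subseteq M_1\subseteq\cdots$ is defined by $M_0=$ the socle of $M$ (sum of all simple subcomodules) and $M_{n+1}/M_n=$ the socle of $M/M_n$; put $M_{-1}=0$. One has $\rho(M_n)\subseteq\sum_{i=0}^n M_i\otimes C_{n-i}$. The associated graded comodule is $\operatorname{gr} M=\bigoplus_{i\ge0}M_i/M_{i-1}$, a graded right $\operatorname{gr} C$-comodule with coaction sending the class of $m\in M_n$ in $M_n/M_{n-1}$ to $\sum_{i=0}^n\overline{m_{0,i}}\otimes\overline{m_{1,n-i}}$, where $\rho(m)=\sum_{i=0}^n m_{0,i}\otimes m_{1,n-i}$ (a sum of such tensors) with $m_{0,i}\in M_i$, $m_{1,n-i}\in C_{n-i}$,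 and the classes are taken in $M_i/M_{i-1}$ and $C_{n-i}/C_{n-i-1}$. A simple right $C$-comodule $S$ satisfies $\rho(S)\subseteq S\otimes C_0$, and is regarded as a (simple) right $\operatorname{gr} C$-comodule via $C_0=\operatorname{gr} C(0)\subseteq\operatorname{gr} C$. *)

(* Defs.v *)
From HB Require Import structures.
From mathcomp Require Import all_boot all_order all_algebra.
From mathcomp Require Import boolp classical_sets.
From mathcomp Require Import finmap monalg.

Set Implicit Arguments.
Unset Strict Implicit.
Unset Printing Implicit Defensive.

Import GRing.Theory.
Local Open Scope ring_scope.

Reserved Notation "V ⊗ W" (at level 40, left associativity).
Reserved Notation "v ⊗ₚ w" (at level 40, left associativity).

(* Vector spaces over k are [lmodType k], of any dimension; a subspace of V is
   a [submodClosed V], membership being made boolean by [`[< _ >]]. *)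

Section Subspaces.
Variables (k : fieldType) (V : lmodType k).

Definition span_pred (P : V -> Prop) : {pred V} := fun v =>
  `[< exists s : seq (k * V), (forall p, p \in s -> P p.2) /\
        v = \sum_(p <- s) p.1 *: p.2 >].

Lemma span_closed P : GRing.subsemimod_closed (span_pred P).
Proof.
split; first split.
- by apply/asboolP; exists [::]; rewrite big_nil; split.
- move=> u v /asboolP[s [sP ->]] /asboolP[t [tP ->]]; apply/asboolP.
  exists (s ++ t); rewrite big_cat; split=> // p.
  by rewrite mem_cat => /orP[/sP|/tP].
- move=> a v /asboolP[s [sP ->]]; apply/asboolP.
  exists [seq (a * p.1, p.2) | p <- s]; split.
    by move=> p /mapP[q /sP qP ->].
  by rewrite big_map scaler_sumr; apply: eq_bigr => p _; rewrite scalerA.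
Qed.
HB.instance Definition _ P :=
  GRing.isSubmodClosed.Build k V (span_pred P) (span_closed P).

Definition span (P : V -> Prop) : submodClosed V := span_pred P.

Definition zerosp : submodClosed V := span (fun=> False).

Definition addsp (A B : {pred V}) : submodClosed V :=
  span (fun v => v \in A \/ v \in B).

Definition sumsp (P : submodClosed V -> Prop) : submodClosed V :=
  span (fun v => exists2 A, P A & v \in A).

End Subspaces.

Section Preimage.
Variables (k : fieldType) (V W : lmodType k) (f : {linear V -> W}).
Variable (A : submodClosed W).

Definition preim_pred : {pred V} := fun v => f v \in A.

Lemma preim_closed : GRing.subsemimod_closed preim_pred.
Proof.
have preimE v : (v \in preim_pred) = (f v \in A) by [].
split; first split=> [|u v]; first by rewrite preimE linear0 rpred0.
  by rewrite !preimE linearD; apply: rpredD.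
by move=> a v; rewrite !preimE linearZ; apply: rpredZ.
Qed.
HB.instance Definition _ :=
  GRing.isSubmodClosed.Build k V preim_pred preim_closed.

Definition preimsp : submodClosed V := preim_pred.

End Preimage.

Section Subtype.
Variables (k : fieldType) (V : lmodType k) (A : submodClosed V).

Record subsp := Subsp { subsp_val : V; subsp_valP : subsp_val \in A }.
HB.instance Definition _ := [isSub for subsp_val].
HB.instance Definition _ := [Choice of subsp by <:].
HB.instance Definition _ := [SubChoice_isSubLmodule of subsp by <:].

Definition incl : {linear subsp -> V} := val.

End Subtype.

Section QuotientSpace.
Variables (k : fieldType) (V : lmodType k) (A : submodClosed V).

Definition quot_pred : {pred V} := fun v => v \in A.

Lemma quot_pred_closed : GRing.zmod_closed quot_pred.
Proof.
have [A0 AB] := GRing.submod_closedB (submodClosedP A).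
by split=> // u v; apply: AB.
Qed.
HB.instance Definition _ :=
  GRing.isZmodClosed.Build V quot_pred quot_pred_closed.

Definition quotsp : Type := Quotient.quot quot_pred.
HB.instance Definition _ := GRing.Zmodule.on quotsp.

Definition quotsp_pi (v : V) : quotsp := (\pi_(Quotient.quot quot_pred) v)%qT.

Lemma quotsp_piP u v : quotsp_pi u = quotsp_pi v <-> u - v \in A.
Proof.
rewrite (_ : (u - v \in A) = (u - v \in quot_pred)) // Quotient.idealrBE.
by split=> [/eqP|/eqP].
Qed.

Lemma quotsp_piB : zmod_morphism quotsp_pi.
Proof. by move=> u v; rewrite /quotsp_pi raddfB. Qed.
HB.instance Definition _ :=
  GRing.isZmodMorphism.Build V quotsp quotsp_pi quotsp_piB.

Lemma quotsp_surj (x : quotsp) : quotsp_pi (repr x) = x.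
Proof. exact: reprK. Qed.

Definition quotsp_scale (a : k) (x : quotsp) : quotsp :=
  quotsp_pi (a *: repr x).

Lemma quotsp_scaleE a v : quotsp_scale a (quotsp_pi v) = quotsp_pi (a *: v).
Proof.
apply/quotsp_piP; rewrite -scalerBr; apply: rpredZ.
by apply/quotsp_piP; rewrite quotsp_surj.
Qed.

Fact quotsp_scaleA a b x :
  quotsp_scale a (quotsp_scale b x) = quotsp_scale (a * b) x.
Proof. by rewrite -(quotsp_surj x) !quotsp_scaleE scalerA. Qed.
Fact quotsp_scale1 : left_id 1 quotsp_scale.
Proof. by move=> x; rewrite -(quotsp_surj x) quotsp_scaleE scale1r. Qed.
Fact quotsp_scaleDr : right_distributive quotsp_scale +%R.
Proof.
move=> a x y; rewrite -(quotsp_surj x) -(quotsp_surj y) -raddfD.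
by rewrite !quotsp_scaleE -raddfD scalerDr.
Qed.
Fact quotsp_scaleDl x : {morph quotsp_scale^~ x : a b / a + b}.
Proof.
move=> a b; rewrite -(quotsp_surj x) !quotsp_scaleE -raddfD.
by rewrite scalerDl.
Qed.
HB.instance Definition _ := GRing.Zmodule_isLmodule.Build k quotsp
  quotsp_scaleA quotsp_scale1 quotsp_scaleDr quotsp_scaleDl.

Lemma quotsp_piZ : scalable quotsp_pi.
Proof. by move=> a v; rewrite -quotsp_scaleE. Qed.
HB.instance Definition _ :=
  GRing.isScalable.Build k V quotsp *:%R quotsp_pi quotsp_piZ.

End QuotientSpace.

(* The direct sum of the V_i: families (v_i) of finite support. *)
Section DirectSum.
Variables (k : fieldType) (V : nat -> lmodType k).

Definition dprod := forall i, V i.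
HB.instance Definition _ := gen_eqMixin dprod.
HB.instance Definition _ := gen_choiceMixin dprod.

Definition dprod_add (f g : dprod) : dprod := fun i => f i + g i.
Definition dprod_opp (f : dprod) : dprod := fun i => - f i.
Definition dprod_zero : dprod := fun=> 0.
Definition dprod_scale (a : k) (f : dprod) : dprod := fun i => a *: f i.

Fact dprod_addA : associative dprod_add.
Proof. by move=> f g h; apply: functional_extensionality_dep => i; apply: addrA. Qed.
Fact dprod_addC : commutative dprod_add.
Proof. by move=> f g; apply: functional_extensionality_dep => i; apply: addrC. Qed.
Fact dprod_add0 : left_id dprod_zero dprod_add.
Proof. by move=> f; apply: functional_extensionality_dep => i; apply: add0r. Qed.
Fact dprod_addN : left_inverse dprod_zero dprod_opp dprod_add.
Proof. by move=> f; apply: functional_extensionality_dep => i; apply: addNr. Qed.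
HB.instance Definition _ :=
  GRing.isZmodule.Build dprod dprod_addA dprod_addC dprod_add0 dprod_addN.

Fact dprod_scaleA a b f : dprod_scale a (dprod_scale b f) = dprod_scale (a * b) f.
Proof. by apply: functional_extensionality_dep => i; apply: scalerA. Qed.
Fact dprod_scale1 : left_id 1 dprod_scale.
Proof. by move=> f; apply: functional_extensionality_dep => i; apply: scale1r. Qed.
Fact dprod_scaleDr : right_distributive dprod_scale +%R.
Proof. by move=> a f g; apply: functional_extensionality_dep => i; apply: scalerDr. Qed.
Fact dprod_scaleDl f : {morph dprod_scale^~ f : a b / a + b}.
Proof. by move=> a b; apply: functional_extensionality_dep => i; apply: scalerDl. Qed.
HB.instance Definition _ := GRing.Zmodule_isLmodule.Build k dprod
  dprod_scaleA dprod_scale1 dprod_scaleDr dprod_scaleDl.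

Definition finsupp_pred : {pred dprod} := fun f =>
  `[< exists n, forall i, (n <= i)%N -> f i = 0 >].

Lemma finsupp_closed : GRing.subsemimod_closed finsupp_pred.
Proof.
split; first split.
- by apply/asboolP; exists 0%N.
- move=> f g /asboolP[m fm] /asboolP[n gn]; apply/asboolP.
  exists (maxn m n) => i; rewrite geq_max => /andP[/fm fi /gn gi].
  by rewrite [LHS](_ : _ = f i + g i) // fi gi addr0.
- move=> a f /asboolP[n fn]; apply/asboolP; exists n => i /fn fi.
  by rewrite [LHS](_ : _ = a *: f i) // fi scaler0.
Qed.
HB.instance Definition _ :=
  GRing.isSubmodClosed.Build k dprod finsupp_pred finsupp_closed.

Definition dsum : lmodType k := subsp (finsupp_pred : submodClosed dprod).

Definition dinj_fun i (v : V i) : dprod :=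
  @dfwith nat V (fun j => 0 : V j) i v.

Lemma dinj_subproof i (v : V i) : dinj_fun v \in finsupp_pred.
Proof.
apply/asboolP; exists i.+1 => j ij; rewrite /dinj_fun dfwith_out //.
by rewrite neq_ltn ij.
Qed.

Definition dinj i (v : V i) : dsum := Subsp (dinj_subproof v).

End DirectSum.

(* The tensor product V ⊗ W: the free vector space on V * W modulo the
   relations of bilinearity. *)
Section Tensor.
Variables (k : fieldType) (V W : lmodType k).

Inductive tens_rel : {malg k[(V * W)%type]} -> Prop :=
  | TensRelL a v v' w : tens_rel (<< (a *: v + v', w) >>
      - (a *: << (v, w) >> + << (v', w) >>))
  | TensRelR a v w w' : tens_rel (<< (v, a *: w + w') >>
      - (a *: << (v, w) >> + << (v, w') >>)).

Definition tens : lmodType k := quotsp (span tens_rel).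

Definition ptens (v : V) (w : W) : tens := quotsp_pi _ << (v, w) >>.

Definition bilin (X : lmodType k) (f : V -> W -> X) : Prop :=
  (forall w, linear (f^~ w)) /\ (forall v, linear (f v)).

(* The linear map V ⊗ W -> X sending v ⊗ w to f v w; this makes sense only for
   f bilinear, see [tliftE] and [tlift_linear]. *)
Definition tlift (X : lmodType k) (f : V -> W -> X) (t : tens) : X :=
  let g := repr t : {malg k[(V * W)%type]} in
  \sum_(p <- msupp g) g@_p *: f p.1 p.2.

Section Universal.
Variables (X : lmodType k) (f : V -> W -> X).

Let ext (g : {malg k[(V * W)%type]}) : X :=
  \sum_(p <- msupp g) g@_p *: f p.1 p.2.

Let extE g (d : {fset (V * W)%type}) : (msupp g `<=` d)%fset ->
  ext g = \sum_(p <- d) g@_p *: f p.1 p.2.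
Proof.
move=> gd; rewrite /ext [RHS](bigID (mem (msupp g))) /=.
rewrite [X in _ + X]big1 ?addr0 => [|p]; last first.
  by move=> /mcoeff_outdom ->; rewrite scale0r.
rewrite -[RHS]big_filter; apply: perm_big; apply: uniq_perm.
- exact: fset_uniq.
- exact/filter_uniq/fset_uniq.
- move=> p; rewrite mem_filter; case: (boolP (p \in msupp g)) => //= pg.
  by rewrite (fsubsetP gd).
Qed.

Let ext_linear : linear ext.
Proof.
move=> a g h; pose d := (msupp g `|` msupp h)%fset.
rewrite (extE (d := d)); last first.
  apply: fsubset_trans (msuppD_le _ _) _.
  by apply: fsetSU; apply: msuppZ_le.
rewrite [ext g](extE (d := d)) ?fsubsetUl // [ext h](extE (d := d)) ?fsubsetUr //.
rewrite scaler_sumr -big_split; apply: eq_bigr => p _ /=.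
by rewrite mcoeffD mcoeffZ scalerDl scalerA.
Qed.

Let extU p : ext << p >> = f p.1 p.2.
Proof.
by rewrite (extE (d := [fset p]%fset)) ?msuppU_le // big_seq_fset1 mcoeffUU scale1r.
Qed.

Hypothesis f_bilin : bilin f.

Let extB g h : ext (g - h) = ext g - ext h.
Proof. by rewrite [g - h]addrC -(scaleN1r h) ext_linear scaleN1r addrC. Qed.

Let ext_rel g : g \in span tens_rel -> ext g = 0.
Proof.
have ext0 : ext 0 = 0 by rewrite -(subrr 0) extB subrr.
move=> /asboolP[s [sP ->]]; elim: s sP => [|p s IHs] sP; first by rewrite big_nil.
rewrite big_cons ext_linear IHs => [|q qs]; last by apply: sP; rewrite inE qs orbT.
rewrite addr0; have /sP : p \in p :: s by rewrite mem_head.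
case=> [a v v' w|a v w w']; rewrite extB ext_linear !extU /=.
  by rewrite (f_bilin.1 w) subrr scaler0.
by rewrite (f_bilin.2 v) subrr scaler0.
Qed.

Let tlift_pi g : tlift f (quotsp_pi _ g) = ext g.
Proof.
apply/eqP; rewrite -subr_eq0 -extB; apply/eqP/ext_rel/quotsp_piP.
exact: quotsp_surj.
Qed.

Lemma tliftE v w : tlift f (ptens v w) = f v w.
Proof. by rewrite tlift_pi extU. Qed.

Lemma tlift_linear : linear (tlift f).
Proof.
move=> a x y; rewrite -(quotsp_surj x) -(quotsp_surj y) -linearP.
by rewrite !tlift_pi ext_linear.
Qed.

End Universal.

End Tensor.

Notation "V ⊗ W" := (tens V W).
Notation "v ⊗ₚ w" := (ptens v w).

Section TensorMaps.
Variable k : fieldType.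
Implicit Types U V W : lmodType k.

(* f ⊗ g, for linear f and g *)
Definition tmap V W V' W' (f : V -> V') (g : W -> W') : V ⊗ W -> V' ⊗ W' :=
  tlift (fun v w => f v ⊗ₚ g w).

Definition tassoc U V W : (U ⊗ V) ⊗ W -> U ⊗ (V ⊗ W) :=
  tlift (fun t w => tlift (fun u v => u ⊗ₚ (v ⊗ₚ w)) t).

(* A ⊗ B, as a subspace of V ⊗ W, for subspaces A and B *)
Definition tsub V W (A : {pred V}) (B : {pred W}) : submodClosed (V ⊗ W) :=
  span (fun t => exists v w, [/\ v \in A, w \in B & t = v ⊗ₚ w]).

(* The linear map characterized by P; it is 0 if there is no such map. In each
   use below the values of the map on a spanning set are prescribed by P, so
   that it is unique, and it exists under the standard hypotheses: N is a
   subcomodule in [quot_comod], the filtrations are compatible with the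
   structure map in [gr_map], and so on. *)
Definition the_linear V W (P : {linear V -> W} -> Prop) : {linear V -> W} :=
  if pselect (exists f, P f) is left h then projT1 (cid h) else \0.

End TensorMaps.

(* [precoalg] and [precomod] carry the structure maps of coalgebras and of
   right comodules; the axioms are [is_coalg] and [is_comod]. *)

Record precoalg (k : fieldType) := Precoalg {
  coalg_sort :> lmodType k;
  comul : {linear coalg_sort -> coalg_sort ⊗ coalg_sort};
  counit : {scalar coalg_sort} }.

Record precomod (k : fieldType) (C : precoalg k) := Precomod {
  comod_sort :> lmodType k;
  coact : {linear comod_sort -> comod_sort ⊗ C} }.

Arguments comul {k C} : rename.
Arguments counit {k C} : rename.
Arguments coact {k C M} : rename.

Definition is_coalg (k : fieldType) (C : precoalg k) : Prop :=
  [/\ forall c : C, tassoc (tmap comul id (comul c)) = tmap id comul (comul c),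
      forall c : C, tlift (fun a b => counit a *: b) (comul c) = c &
      forall c : C, tlift (fun a b => counit b *: a) (comul c) = c].

Section Comodules.
Variables (k : fieldType) (C : precoalg k).
Implicit Types M N I S E : precomod C.

Definition is_comod M : Prop :=
  (forall m : M, tassoc (tmap coact id (coact m)) = tmap id comul (coact m)) /\
  (forall m : M, tlift (fun x c => counit c *: x) (coact m) = m).

Definition is_hom M N (f : {linear M -> N}) : Prop :=
  forall m, coact (f m) = tmap f id (coact m).

Definition comod_iso M N : Prop :=
  exists2 f : {linear M -> N}, is_hom f & bijective f.

Definition is_subcomod M (N : submodClosed M) : Prop :=
  forall m, m \in N -> coact m \in tsub N (predT : {pred C}).

Definition simple_subcomod M (N : submodClosed M) : Prop :=
  [/\ is_subcomod N, exists2 x, x \in N & x != 0 &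
      forall N' : submodClosed M, is_subcomod N' -> {subset N' <= N} ->
        (forall x, x \in N' -> x = 0) \/ {subset N <= N'}].

Definition simple_comod M : Prop :=
  (exists x : M, x != 0) /\
  forall N : submodClosed M, is_subcomod N ->
    (forall x, x \in N -> x = 0) \/ (forall x, x \in N).

Definition socle M : submodClosed M := sumsp (@simple_subcomod M).

(* M / N, for N a subcomodule *)
Definition quot_comod M (N : submodClosed M) : precomod C :=
  @Precomod k C (quotsp N) (the_linear (fun r : {linear quotsp N -> quotsp N ⊗ C} =>
    forall m : M, r (quotsp_pi N m) = tmap (quotsp_pi N) id (coact m))).

Fixpoint loewy M (n : nat) : submodClosed M :=
  if n is n'.+1
  then preimsp (quotsp_pi (loewy M n')) (socle (quot_comod (loewy M n')))
  else socle M.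

Definition injective_comod I : Prop :=
  is_comod I /\
  forall M N (i : {linear M -> N}) (f : {linear M -> I}),
    is_comod M -> is_comod N -> is_hom i -> injective i -> is_hom f ->
    exists2 g : {linear N -> I}, is_hom g & forall m, g (i m) = f m.

(* i exhibits E as an injective envelope of S: E is injective and i is an
   essential monomorphism. *)
Definition injective_envelope S E (i : {linear S -> E}) : Prop :=
  [/\ injective_comod E, is_hom i, injective i &
      forall N : submodClosed E, is_subcomod N -> (exists2 x, x \in N & x != 0) ->
        exists2 s, i s \in N & s != 0].

End Comodules.

Section CoradicalFiltration.
Variables (k : fieldType) (C : precoalg k).

Definition is_subcoalg (D : submodClosed C) : Prop :=
  forall c, c \in D -> comul c \in tsub D D.

Definition simple_subcoalg (D : submodClosed C) : Prop :=
  [/\ is_subcoalg D, exists2 x, x \in D & x != 0 &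
      forall D' : submodClosed C, is_subcoalg D' -> {subset D' <= D} ->
        (forall x, x \in D' -> x = 0) \/ {subset D <= D'}].

Definition coradical : submodClosed C := sumsp simple_subcoalg.

Fixpoint coradf (n : nat) : submodClosed C :=
  if n is n'.+1
  then preimsp comul (addsp (tsub (coradf n') predT) (tsub predT coradical))
  else coradical.

End CoradicalFiltration.

Section AssociatedGraded.
Variable k : fieldType.

Section Graded.
Variables (V : lmodType k) (F : nat -> submodClosed V).

Definition prevf (n : nat) : submodClosed V :=
  if n is n'.+1 then F n' else zerosp V.

Definition gr_piece (n : nat) : lmodType k :=
  quotsp (preimsp (incl (F n)) (prevf n)).

Definition gr : lmodType k := dsum gr_piece.

(* the class of v in F_n / F_(n-1), as an element of gr *)
Definition gr_cls n (v : subsp (F n)) : gr := dinj (quotsp_pi _ v : gr_piece n).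

End Graded.

(* The map gr V -> gr V' ⊗ gr W induced by r : V -> V' ⊗ W, where
   r (F_n) is contained in the sum of the F'_i ⊗ G_(n-i): if v in F_n and
   r v = \sum_i \sum_(p <- s i) p.1 ⊗ p.2 with p.1 in F'_i and p.2 in G_(n-i),
   then the class of v is sent to \sum_i \sum_(p <- s i) [p.1] ⊗ [p.2]. *)
Definition gr_map (V V' W : lmodType k) (F : nat -> submodClosed V)
    (F' : nat -> submodClosed V') (G : nat -> submodClosed W)
    (r : V -> V' ⊗ W) : {linear gr F -> gr F' ⊗ gr G} :=
  the_linear (fun h : {linear gr F -> gr F' ⊗ gr G} =>
    forall n (v : subsp (F n))
           (s : forall i : 'I_n.+1, seq (subsp (F' i) * subsp (G (n - i)%N))),
      r (val v) = \sum_(i < n.+1) \sum_(p <- s i) val p.1 ⊗ₚ val p.2 ->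
      h (gr_cls v) = \sum_(i < n.+1) \sum_(p <- s i) gr_cls p.1 ⊗ₚ gr_cls p.2).

(* The counit of gr C is the counit of C on C_0, and 0 on C_n / C_(n-1), n > 0. *)
Definition gr_coalg (C : precoalg k) : precoalg k :=
  let F := @coradf k C in
  @Precoalg k (gr F) (gr_map F F F comul)
    (the_linear (fun e : {linear gr F -> k^o} =>
       forall n (c : subsp (F n)),
         e (gr_cls c) = if n == 0%N then counit (val c) else 0)).

Definition gr_comod (C : precoalg k) (M : precomod C) : precomod (gr_coalg C) :=
  let F := @loewy k C M in
  @Precomod k (gr_coalg C) (gr F) (gr_map F F (@coradf k C) coact).

(* The comodule S over gr C, for a comodule S over C whose coaction takes its
   values in S ⊗ C_0 (as for S simple), through C_0 = gr C (0). *)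
Definition deg0_comod (C : precoalg k) (S : precomod C) : precomod (gr_coalg C) :=
  @Precomod k (gr_coalg C) S
    (the_linear (fun r : {linear S -> S ⊗ gr (@coradf k C)} =>
       forall (x : S) (s : seq (S * subsp (coradf C 0))),
         coact x = \sum_(p <- s) p.1 ⊗ₚ val p.2 ->
         r x = \sum_(p <- s) p.1 ⊗ₚ gr_cls p.2)).

End AssociatedGraded.

(* Main.v *)
(* A right comodule M is studied through the action f.m = (id ⊗ f)(rho m) of the
   functionals f on C: subcomodules are the stable subspaces, homomorphisms the
   equivariant maps. Writing D^perp for the functionals vanishing on D, the
   Loewy series is M_n = {m | (C_n)^perp.m = 0}. For n = 0, the coefficients of
   a simple subcomodule span a simple subcoalgebra, and conversely M embeds
   through rho in M ⊗ C, where M ⊗ C_0 is a sum of simple subcomodules. As a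
   consequence homomorphisms preserve Loewy series, and (C_i)^perp M_n is
   contained in M_(n-i-1).

   Since S is simple, E = E(S) is a direct summand of the comodule C, so gr E is
   a direct summand of gr C, which is injective over itself. Finally gr E is an
   essential extension of gr E(0) = S: if the class of m in M_n / M_(n-1) is
   nonzero, some f vanishing on C_(n-1) has f.m nonzero, and f induces a
   functional on gr C of degree n mapping the class of m to f.m in M_0. *)

From HB Require Import structures.
From mathcomp Require Import all_boot all_order all_algebra.
From mathcomp Require Import boolp classical_sets.
From mathcomp Require Import finmap monalg zify.
Require Import Defs.

Set Implicit Arguments.
Unset Strict Implicit.
Unset Printing Implicit Defensive.

Import GRing.Theory.
Local Open Scope ring_scope.

(** * Subspaces and projections *)

(** Tensors are classes in a quotient of a free module, without normal form, and no space comes with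
    a basis. Zorn's lemma supplies projections onto arbitrary subspaces; thanks to them,
    contractions by functionals separate tensors and detect membership in A ⊗ B and in A ⊗ W + V ⊗
    B. Hence passing to functionals loses nothing: coassociativity becomes associativity of the
    convolution product, and the wedge defining C_(n+1) becomes a product of annihilators. The
    obstacle is that the structure maps of quotients, of gr C and of gr M are given by [the_linear],
    so nothing is known of them until some map with the prescribed values is produced. For gr, the
    single linear formula [symbol] serves all decompositions at once. Contracted, it says that a
    functional on gr C acts through its homogeneous components ([gr_act]); the axioms for gr,
    functoriality and essentiality are all read off from this formula. The final isomorphism is the
    uniqueness of injective envelopes, gr E being shown to be one. *)

Lemma ex_linear (k : fieldType) (V W : lmodType k) (f : V -> W) :
  linear f -> exists g : {linear V -> W}, g =1 f.
Proof.
move=> lf; pose h := GRing.isLinear.Build k V W *:%R f lf.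
by exists (HB.pack_for {linear V -> W} f h).
Qed.

Lemma ex_scalar (k : fieldType) (V : lmodType k) (f : V -> k) :
  scalar f -> exists g : {scalar V}, g =1 f.
Proof.
move=> lf; pose h := GRing.isLinear.Build k V k *%R f lf.
by exists (HB.pack_for {scalar V} f h).
Qed.

Section SpanTheory.
Variables (k : fieldType) (V : lmodType k).
Implicit Types A B : submodClosed V.

Lemma submodN A v : v \in A -> - v \in A.
Proof. by rewrite -scaleN1r; apply: rpredZ. Qed.

Lemma submodB A u v : u \in A -> v \in A -> u - v \in A.
Proof. by move=> uA vA; apply: rpredD => //; apply: submodN. Qed.

Lemma mem_span (P : V -> Prop) v : P v -> v \in span P.
Proof.
move=> Pv; apply/asboolP; exists [:: (1, v)].
by rewrite big_seq1 scale1r; split=> // p; rewrite inE => /eqP->.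
Qed.

Lemma span_sub (P : V -> Prop) A :
  (forall v, P v -> v \in A) -> {subset span P <= A}.
Proof.
move=> PA v /asboolP[s [sP ->]]; rewrite big_seq; apply: rpred_sum => p ps.
exact/rpredZ/PA/sP.
Qed.

Lemma span_sum (P : V -> Prop) v :
  (forall a u, P u -> P (a *: u)) -> v \in span P ->
  exists2 s : seq V, (forall u, u \in s -> P u) & v = \sum_(u <- s) u.
Proof.
move=> PZ /asboolP[s [sP ->]]; exists [seq p.1 *: p.2 | p <- s].
  by move=> u /mapP[p ps ->]; apply/PZ/sP.
by rewrite big_map.
Qed.

Lemma addspP A B v :
  v \in addsp A B <-> exists a b, [/\ a \in A, b \in B & v = a + b].
Proof.
split=> [|[a [b [aA bB ->]]]]; last first.
  by apply: rpredD; apply: mem_span; [left|right].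
move=> /asboolP[s [sP ->]]; elim: s sP => [|p s IHs] sP.
  by rewrite big_nil; exists 0, 0; rewrite !rpred0 addr0.
have [|a [b [aA bB E]]] := IHs.
  by move=> q qs; apply: sP; rewrite inE qs orbT.
rewrite big_cons E; have [pA|pB] := sP p (mem_head _ _).
  exists (p.1 *: p.2 + a), b; split; rewrite ?addrA //.
  by apply: rpredD => //; apply: rpredZ.
exists a, (p.1 *: p.2 + b); split; rewrite // 1?addrCA //.
by apply: rpredD => //; apply: rpredZ.
Qed.

Lemma zerospP v : v \in zerosp V <-> v = 0.
Proof.
split=> [|->]; last exact: rpred0.
move=> /asboolP[s [sP ->]]; rewrite big_seq big1 // => p ps.
by case: (sP p ps).
Qed.

Definition line (v : V) : submodClosed V := span (eq v).

Lemma lineP v u : u \in line v <-> exists a, u = a *: v.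
Proof.
split=> [|[a ->]]; last by apply: rpredZ; apply: mem_span.
move=> /asboolP[s [sP ->]]; exists (\sum_(p <- s) p.1).
by rewrite scaler_suml; apply: eq_big_seq => p /sP ->.
Qed.

End SpanTheory.

Section ImageSpace.
Variables (k : fieldType) (V W : lmodType k).
Implicit Types A : submodClosed V.

Definition imsp (f : {linear V -> W}) A : submodClosed W :=
  span (fun w => exists2 v, v \in A & w = f v).

Lemma imspP (f : {linear V -> W}) A w :
  w \in imsp f A <-> exists2 v, v \in A & w = f v.
Proof.
split=> [|wA]; last exact: mem_span.
move=> /span_sum[a u [v vA ->]|s sP ->].
  by exists (a *: v); rewrite ?linearZ // rpredZ.
elim: s sP => [|u s IHs] sP.
  by exists 0; rewrite ?big_nil ?linear0 ?rpred0.
have [v vA E] := sP _ (mem_head _ _).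
have [|v' v'A E'] := IHs; first by move=> x xs; apply: sP; rewrite inE xs orbT.
by exists (v + v'); rewrite ?big_cons ?linearD -?E -?E' // rpredD.
Qed.

Lemma preimspP (f : {linear V -> W}) (B : submodClosed W) v :
  (v \in preimsp f B) = (f v \in B).
Proof. by []. Qed.

End ImageSpace.

Section Projections.
Variables (k : fieldType) (V : lmodType k).
Implicit Types A B : submodClosed V.

Lemma ex_compl A : exists B,
  (forall v, v \in A -> v \in B -> v = 0) /\
  (forall v, exists a b, [/\ a \in A, b \in B & v = a + b]).
Proof.
pose T := {B : submodClosed V | forall v, v \in A -> v \in B -> v = 0}.
pose R (B B' : T) := `[< {subset sval B <= sval B'} >].
have t0 : T.
  by exists (zerosp V) => v _ /zerospP.
have [|B1 B2 B3|Z Ztot|[B BA] Bmax] := @ZL_preorder T t0 R.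
- by move=> B; apply/asboolP.
- by move=> /asboolP B12 /asboolP B23; apply/asboolP => v /B12/B23.
- pose U := span (fun v => exists2 B, Z B & v \in sval B).
  (* The span of a chain is its union; the alternative v = 0 serves the empty chain. *)
  have UP v : v \in U -> v = 0 \/ exists2 B, Z B & v \in sval B.
    move=> /span_sum[a u [B ZB uB]|s sP ->].
      by exists B => //; apply: rpredZ.
    elim: s sP => [|u s IHs] sP; first by rewrite big_nil; left.
    rewrite big_cons; right.
    have [B ZB uB] := sP u (mem_head _ _).
    have [|->|[B' ZB' sB']] := IHs; first 2 last.
    + have [/asboolP BB'|/asboolP B'B] := Ztot B B' ZB ZB'.
        by exists B' => //; apply: rpredD => //; apply: BB'.
      by exists B => //; apply: rpredD => //; apply: B'B.
    + by move=> x xs; apply: sP; rewrite inE xs orbT.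
    + by exists B; rewrite // addr0.
  have UA v : v \in A -> v \in U -> v = 0.
    by move=> vA /UP[//|[B ZB vB]]; apply: (svalP B).
  exists (exist _ U UA) => B ZB; apply/asboolP => v vB.
  by apply: mem_span; exists B.
exists B; split=> // v.
suff: v \in addsp A B by move=> /addspP.
apply: contrapT => vAB; apply: (vAB); apply/addspP.
(* For v outside A + B, the subspace B + [line v] still meets A trivially, so maximality forces v
   into B. *)
have BvA u : u \in A -> u \in addsp B (line v) -> u = 0.
  move=> uA /addspP[b [w [bB /lineP[c ->] uE]]].
  have [c0|c0] := eqVneq c 0.
    by apply: (BA u); rewrite // uE c0 scale0r addr0.
  case: vAB; apply/addspP; exists (c^-1 *: u), (- (c^-1 *: b)).
  split; rewrite ?rpredZ ?submodN ?rpredZ //.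
  by rewrite uE scalerDr scalerA mulVf // scale1r addrAC subrr add0r.
have /asboolP/= vB : R (exist _ _ BvA) (exist _ B BA).
  by apply: Bmax; apply/asboolP => u uB /=; apply: mem_span; left.
exists 0, v; rewrite rpred0 add0r; split=> //; apply: vB.
by apply: mem_span; right; apply: mem_span.
Qed.

Lemma ex_proj A : exists p : {linear V -> V},
  (forall v, p v \in A) /\ (forall a, a \in A -> p a = a).
Proof.
have [B [AB0 ABT]] := ex_compl A.
have H v : exists a, a \in A /\ v - a \in B.
  by have [a [b [aA bB ->]]] := ABT v; exists a; rewrite addrAC subrr add0r.
have [p pP] := choice H.
have p_uniq v a : a \in A -> v - a \in B -> p v = a.
  move=> aA aB; apply/eqP; rewrite -subr_eq0; apply/eqP; apply: AB0.
    by rewrite submodB // (pP v).1.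
  have -> : p v - a = (v - a) - (v - p v).
    by rewrite opprB [RHS]addrC addrA subrK.
  by rewrite submodB // (pP v).2.
have [c u v|q qE] := @ex_linear _ _ _ p.
  apply: p_uniq; first by rewrite rpredD ?rpredZ // ?(pP _).1.
  rewrite opprD addrACA -scalerBr rpredD ?rpredZ // ?(pP _).2 //.
exists q; split=> [v|a aA]; rewrite qE; first exact: (pP v).1.
by apply: p_uniq; rewrite // subrr rpred0.
Qed.

Lemma ex_scalar1 v : v != 0 -> exists f : {scalar V}, f v = 1.
Proof.
move=> v0; have [p [pv pid]] := ex_proj (line v).
have /choice[f fP] u : exists a, p u = a *: v by apply/lineP.
have inj a b : a *: v = b *: v -> a = b.
  move=> /eqP; rewrite -subr_eq0 -scalerBl scaler_eq0 (negPf v0) orbF.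
  by rewrite subr_eq0 => /eqP.
have [c u w|g gE] := @ex_scalar _ _ f.
  by apply: inj; rewrite -fP linearP !fP scalerDl scalerA.
exists g; rewrite gE; apply: inj; rewrite -fP scale1r pid //.
exact: mem_span.
Qed.

Lemma scalar_sep v : (forall f : {scalar V}, f v = 0) -> v = 0.
Proof.
move=> fv; apply/eqP; apply: contraT => /ex_scalar1[f].
by rewrite fv => /esym/eqP; rewrite oner_eq0.
Qed.

Lemma ex_ext (A : submodClosed V) (W : lmodType k) (h : {linear subsp A -> W}) :
  exists g : {linear V -> W}, forall a : subsp A, g (val a) = h a.
Proof.
have [p [pA pid]] := ex_proj A.
have [c u v|g gE] := @ex_linear _ V W (fun v => h (Subsp (pA v))).
  rewrite -linearP; congr (h _); apply: val_inj => /=.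
  by rewrite linearP.
by exists g => a; rewrite gE; congr (h _); apply/val_inj/pid/valP.
Qed.

(** For a projection p onto A, every f \o (id - p) kills A; hence all functionals vanish on v - p v.
    This turns membership in a term of the coradical filtration into a test on functionals. *)
Lemma annihP A v :
  v \in A <-> forall f : {scalar V}, (forall a, a \in A -> f a = 0) -> f v = 0.
Proof.
split=> [vA f /(_ v vA)//|H].
have [p [pA pid]] := ex_proj A.
suff /eqP: v - p v = 0 by rewrite subr_eq0 => /eqP->.
apply: scalar_sep => f; rewrite linearB.
have [|g gE] := @ex_scalar _ _ (fun u => f u - f (p u)).
  by move=> a x y; rewrite !linearP mulrBr opprD addrACA.
by rewrite -gE; apply: H => a aA; rewrite gE pid // subrr.
Qed.

End Projections.

Lemma scalar_ext (k : fieldType) (V W : lmodType k) (i : {linear V -> W})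
    (f : {scalar V}) : injective i ->
  exists g : {scalar W}, forall v, g (i v) = f v.
Proof.
move=> inj_i.
have [p [pI pid]] := ex_proj (imsp i (span (fun=> True))).
have /choice[r rP] w : exists v, p w = i v.
  by have /imspP[v _ ->] := pI w; exists v.
have [|g gE] := @ex_scalar _ _ (f \o r).
  by move=> a u w /=; rewrite -linearP; congr (f _); apply: inj_i;
    rewrite linearP -!rP linearP.
exists g => v; rewrite gE /=; congr (f _); apply: inj_i.
by rewrite -rP pid //; apply/imspP; exists v => //; apply: mem_span.
Qed.

(** * Tensor products *)

Section TensorBasics.
Variables (k : fieldType) (V W : lmodType k).
Implicit Types (v : V) (w : W) (t : V ⊗ W).

Lemma ptens_bilin : bilin (@ptens k V W).
Proof.
split=> [w a u v|v a u w]; rewrite /ptens -linearP; apply/quotsp_piP.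
  exact: mem_span (TensRelL _ _ _ _).
exact: mem_span (TensRelR _ _ _ _).
Qed.

Lemma ptensDl u v w : (u + v) ⊗ₚ w = u ⊗ₚ w + v ⊗ₚ w.
Proof. by rewrite -[u]scale1r ptens_bilin.1 !scale1r. Qed.

Lemma ptensDr v u w : v ⊗ₚ (u + w) = v ⊗ₚ u + v ⊗ₚ w.
Proof. by rewrite -[u]scale1r ptens_bilin.2 !scale1r. Qed.

Lemma ptens0l w : (0 : V) ⊗ₚ w = 0.
Proof. by apply: (addrI (0 ⊗ₚ w)); rewrite -ptensDl !addr0. Qed.

Lemma ptens0r v : v ⊗ₚ (0 : W) = 0.
Proof. by apply: (addrI (v ⊗ₚ 0)); rewrite -ptensDr !addr0. Qed.

Lemma ptensZl a v w : (a *: v) ⊗ₚ w = a *: (v ⊗ₚ w).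
Proof. by rewrite -[_ *: v]addr0 ptens_bilin.1 ptens0l addr0. Qed.

Lemma ptensZr a v w : v ⊗ₚ (a *: w) = a *: (v ⊗ₚ w).
Proof. by rewrite -[_ *: w]addr0 ptens_bilin.2 ptens0r addr0. Qed.

Lemma tens_sum t : exists s : seq (V * W), t = \sum_(p <- s) p.1 ⊗ₚ p.2.
Proof.
rewrite -(quotsp_surj t); move: (repr t) => /= g; rewrite (monalgE g).
exists [seq (g@_p *: p.1, p.2) | p <- msupp g].
rewrite big_map linear_sum; apply: eq_bigr => -[v w] _ /=.
rewrite ptensZl /ptens.
have -> : << g@_(v, w) *g (v, w) >> = g@_(v, w) *: << (v, w) >> :> {malg k[(V *
  W)%type]}.
  by apply/malgP => q; rewrite mcoeffZ !mcoeffU mulrnAr mulr1.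
by rewrite linearZ.
Qed.

Lemma tens_lin_eq (X : lmodType k) (f g : V ⊗ W -> X) :
  linear f -> linear g -> (forall v w, f (v ⊗ₚ w) = g (v ⊗ₚ w)) -> f =1 g.
Proof.
move=> /ex_linear[f' fE] /ex_linear[g' gE] fg t; rewrite -fE -gE.
have [s ->] := tens_sum t; rewrite !linear_sum; apply: eq_bigr => p _.
by rewrite fE gE.
Qed.

End TensorBasics.

(* [rcon f] is id ⊗ f and [lcon f] is f ⊗ id. They are locked because the sum in
   the body of [tlift] is otherwise a target for [linear_sum]. *)
HB.lock Definition rcon (k : fieldType) (V W : lmodType k) (f : {scalar W})
  (t : V ⊗ W) : V := tlift (fun v w => f w *: v) t.
HB.lock Definition lcon (k : fieldType) (V W : lmodType k) (f : {scalar V})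
  (t : V ⊗ W) : W := tlift (fun v w => f v *: w) t.

Section Contractions.
Variables (k : fieldType) (V W : lmodType k).
Implicit Types (v : V) (w : W) (t : V ⊗ W).

Lemma rcon_bilin (f : {scalar W}) : bilin (fun v w => f w *: v).
Proof.
split=> [w a u v|v a u w].
  by rewrite scalerDr scalerA mulrC -scalerA.
by rewrite linearP scalerDl scalerA.
Qed.

Lemma lcon_bilin (f : {scalar V}) : bilin (fun v w => f v *: w).
Proof.
split=> [w a u v|v a u w].
  by rewrite linearP scalerDl scalerA.
by rewrite scalerDr scalerA mulrC -scalerA.
Qed.

Lemma rcon_tlift (f : {scalar W}) t : tlift (fun v w => f w *: v) t = rcon f t.
Proof. by rewrite rcon.unlock. Qed.

Lemma lcon_tlift (f : {scalar V}) t : tlift (fun v w => f v *: w) t = lcon f t.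
Proof. by rewrite lcon.unlock. Qed.

Lemma rcon_linear (f : {scalar W}) : linear (rcon f : V ⊗ W -> V).
Proof. by rewrite rcon.unlock; apply/tlift_linear/rcon_bilin. Qed.
HB.instance Definition _ (f : {scalar W}) :=
  GRing.isLinear.Build k _ _ _ (rcon f) (rcon_linear f).

Lemma lcon_linear (f : {scalar V}) : linear (lcon f : V ⊗ W -> W).
Proof. by rewrite lcon.unlock; apply/tlift_linear/lcon_bilin. Qed.
HB.instance Definition _ (f : {scalar V}) :=
  GRing.isLinear.Build k _ _ _ (lcon f) (lcon_linear f).

Lemma rconE f v w : rcon f (v ⊗ₚ w) = f w *: v.
Proof. by rewrite -rcon_tlift (tliftE (rcon_bilin f)). Qed.

Lemma lconE f v w : lcon f (v ⊗ₚ w) = f v *: w.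
Proof. by rewrite -lcon_tlift (tliftE (lcon_bilin f)). Qed.

Lemma rcon_lcon (f : {scalar V}) (g : {scalar W}) t :
  f (rcon g t) = g (lcon f t).
Proof.
have [s ->] := tens_sum t; rewrite !linear_sum; apply: eq_bigr => p _.
by rewrite /= rconE lconE !linearZ /= mulrC.
Qed.

(** Induction on the number of terms. If f w = 1, contracting by f expresses v through the other
    left factors; substituting this for v removes the term v ⊗ w and changes each other right factor
    by a multiple of w. *)
Lemma rcon_inj t : (forall f, rcon f t = 0) -> t = 0.
Proof.
have [s ->] := tens_sum t; move En: (size s) => n.
elim: n s En => [|n IHn] [|[v w] s]//= => [|[sn]]; first by rewrite big_nil.
have [w0 H|/ex_scalar1[f fw] H] := eqVneq w 0.
  move: H; rewrite big_cons w0 ptens0r add0r; exact: IHn.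
have vE : v = - \sum_(p <- s) f p.2 *: p.1.
  apply/eqP; rewrite -addr_eq0; apply/eqP; rewrite -[RHS](H f) linear_sum.
  rewrite big_cons /= rconE fw scale1r; congr (_ + _).
  by apply: eq_bigr => p _; rewrite rconE.
pose s' := [seq (p.1, p.2 - f p.2 *: w) | p <- s].
have s'E : \sum_(p <- (v, w) :: s) p.1 ⊗ₚ p.2 = \sum_(p <- s') p.1 ⊗ₚ p.2.
  have [L LE] := ex_linear ((ptens_bilin V W).1 w).
  rewrite big_cons big_map /= {1}vE -LE linearN linear_sum addrC -sumrB.
  by apply: eq_bigr => p _; rewrite LE -scaleNr ptensDr ptensZr ptensZl scaleNr.
by rewrite s'E in H *; apply: IHn; rewrite ?size_map.
Qed.

Lemma lcon_inj t : (forall f, lcon f t = 0) -> t = 0.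
Proof.
move=> H; apply: rcon_inj => g; apply: scalar_sep => f.
by rewrite rcon_lcon H linear0.
Qed.

Lemma bcon_inj t :
  (forall (f : {scalar V}) (g : {scalar W}), f (rcon g t) = 0) -> t = 0.
Proof. by move=> H; apply: rcon_inj => g; apply: scalar_sep => f. Qed.

Lemma bcon_eq t t' :
  (forall (f : {scalar V}) (g : {scalar W}), f (rcon g t) = f (rcon g t')) ->
  t = t'.
Proof.
move=> H; apply/eqP; rewrite -subr_eq0; apply/eqP; apply: bcon_inj => f g.
by rewrite !linearB /= H subrr.
Qed.

Lemma rcon_eq t t' : (forall g : {scalar W}, rcon g t = rcon g t') -> t = t'.
Proof. by move=> H; apply: bcon_eq => f g; rewrite H. Qed.

Lemma rcon_fun_eq (f g : {scalar W}) t : f =1 g -> rcon f t = rcon g t.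
Proof.
move=> fg; rewrite -!rcon_tlift; congr tlift.
by apply: funext => v; apply: funext => w; rewrite fg.
Qed.

Lemma rconP a (f g h : {scalar W}) t : h =1 (fun w => a * f w + g w) ->
  rcon h t = a *: rcon f t + rcon g t.
Proof.
move=> hE; apply: (tens_lin_eq (f := rcon h)
  (g := fun t => a *: rcon f t + rcon g t)) => [||v w].
- exact: rcon_linear.
- by move=> b x y; rewrite !rcon_linear !scalerDr !scalerA addrACA [a * b]mulrC.
- by rewrite !rconE hE scalerDl scalerA.
Qed.

Lemma rconB (f g h : {scalar W}) t : h =1 (fun w => f w - g w) ->
  rcon h t = rcon f t - rcon g t.
Proof.
move=> hE; rewrite (@rconP 1 h g f) ?scale1r ?addrK // => w.
by rewrite hE mul1r subrK.
Qed.

Lemma lcon_fun_eq (f g : {scalar V}) t : f =1 g -> lcon f t = lcon g t.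
Proof.
move=> fg; rewrite -!lcon_tlift; congr tlift.
by apply: funext => v; apply: funext => w; rewrite fg.
Qed.

End Contractions.

Section TensorMaps.
Variables (k : fieldType) (V W V' W' : lmodType k).

Lemma tmap_bilin (f : {linear V -> V'}) (g : {linear W -> W'}) :
  bilin (fun v w => f v ⊗ₚ g w).
Proof.
by split=> [w a u v|v a u w]; rewrite linearP ?ptensDl ?ptensDr ?ptensZl
  ?ptensZr.
Qed.

Lemma tmap_linear (f : {linear V -> V'}) (g : {linear W -> W'}) :
  linear (tmap f g).
Proof. exact/tlift_linear/tmap_bilin. Qed.

HB.instance Definition _ (f : {linear V -> V'}) (g : {linear W -> W'}) :=
  GRing.isLinear.Build k _ _ _ (tmap f g) (tmap_linear f g).

Lemma tmapE (f : {linear V -> V'}) (g : {linear W -> W'}) v w :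
  tmap f g (v ⊗ₚ w) = f v ⊗ₚ g w.
Proof. exact: tliftE (tmap_bilin f g) v w. Qed.

Lemma ex_tmap (f : {linear V -> V'}) (g : {linear W -> W'}) :
  exists2 h : {linear V ⊗ W -> V' ⊗ W'}, h =1 tmap f g &
    forall v w, h (v ⊗ₚ w) = f v ⊗ₚ g w.
Proof.
have [h hE] := ex_linear (tmap_linear f g).
by exists h => // v w; rewrite hE tmapE.
Qed.

Lemma rcon_tmap (f : {linear V -> V'}) (g : {linear W -> W'}) (h : {scalar W'})
  t :
  rcon h (tmap f g t) = f (rcon (h \o g) t).
Proof.
have [F FE FP] := ex_tmap f g; rewrite -FE.
have [s ->] := tens_sum t; rewrite !linear_sum; apply: eq_bigr => p _ /=.
by rewrite FP !rconE linearZ.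
Qed.

Lemma lcon_tmap (f : {linear V -> V'}) (g : {linear W -> W'}) (h : {scalar V'})
  t :
  lcon h (tmap f g t) = g (lcon (h \o f) t).
Proof.
have [F FE FP] := ex_tmap f g; rewrite -FE.
have [s ->] := tens_sum t; rewrite !linear_sum; apply: eq_bigr => p _ /=.
by rewrite FP !lconE linearZ.
Qed.

Lemma mem_tmap (f : {linear V -> V'}) (g : {linear W -> W'})
    (A : {pred V'}) (B : {pred W'}) t :
  (forall v, f v \in A) -> (forall w, g w \in B) -> tmap f g t \in tsub A B.
Proof.
move=> fA gB; have [F FE FP] := ex_tmap f g; rewrite -FE.
have [s ->] := tens_sum t; rewrite linear_sum; apply: rpred_sum => p _.
by apply: mem_span; exists (f p.1), (g p.2); rewrite FP.
Qed.

End TensorMaps.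

Section TensorSubspaces.
Variables (k : fieldType) (V W : lmodType k).
Implicit Types (t : V ⊗ W) (A : submodClosed V) (B : submodClosed W).

Lemma rcon_tmapl (V' : lmodType k) (f : {linear V -> V'}) (h : {scalar W}) t :
  rcon h (tmap f id t) = f (rcon h t).
Proof.
rewrite (rcon_tmap f idfun).
by congr (f _); apply: rcon_fun_eq.
Qed.

Lemma rcon_tmapr (W' : lmodType k) (g : {linear W -> W'}) (h : {scalar W'}) t :
  rcon h (tmap id g t) = rcon (h \o g) t.
Proof. by rewrite (rcon_tmap idfun g). Qed.

Lemma lcon_tmapr (W' : lmodType k) (g : {linear W -> W'}) (h : {scalar V}) t :
  lcon h (tmap id g t) = g (lcon h t).
Proof.
rewrite (lcon_tmap idfun g).
by congr (g _); apply: lcon_fun_eq.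
Qed.

(** With projections p onto A and q onto B, the two conditions say that p ⊗ q fixes t. *)
Lemma tsubP A B t : t \in tsub A B <->
  (forall f, rcon f t \in A) /\ (forall f, lcon f t \in B).
Proof.
split=> [/span_sum[a _ [v [w [vA wB ->]]]|s sP ->]|[tA tB]].
- by exists (a *: v), w; rewrite ptensZl; split=> //; apply: rpredZ.
- split=> f; rewrite linear_sum big_seq; apply: rpred_sum => u /sP.
    by move=> [v [w [vA wB ->]]] /=; rewrite rconE; apply: rpredZ.
  by move=> [v [w [vA wB ->]]] /=; rewrite lconE; apply: rpredZ.
have [p [pA pid]] := ex_proj A; have [q [qB qid]] := ex_proj B.
suff -> : t = tmap p q t by apply: mem_tmap.
apply: bcon_eq => f g.
by rewrite rcon_tmap pid // rcon_lcon [RHS]rcon_lcon /= qid.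
Qed.

Lemma tsubTP A t : t \in tsub A (predT : {pred W}) <-> forall f, rcon f t \in A.
Proof.
split=> [/span_sum[a _ [v [w [vA wB ->]]]|s sP -> f]|tA].
- by exists (a *: v), w; rewrite ptensZl; split=> //; apply: rpredZ.
- rewrite linear_sum big_seq; apply: rpred_sum => u /sP.
  by move=> [v [w [vA wB ->]]] /=; rewrite rconE; apply: rpredZ.
have [p [pA pid]] := ex_proj A.
suff -> : t = tmap p idfun t by apply: mem_tmap.
by apply: rcon_eq => g; rewrite rcon_tmapl pid.
Qed.

Lemma tsubTrP B t : t \in tsub (predT : {pred V}) B <->
  forall f, lcon f t \in B.
Proof.
split=> [/span_sum[a _ [v [w [vA wB ->]]]|s sP -> f]|tB].
- by exists (a *: v), w; rewrite ptensZl; split=> //; apply: rpredZ.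
- rewrite linear_sum big_seq; apply: rpred_sum => u /sP.
  by move=> [v [w [vA wB ->]]] /=; rewrite lconE; apply: rpredZ.
have [p [pB pid]] := ex_proj B.
suff -> : t = tmap idfun p t by apply: mem_tmap.
by apply: bcon_eq => f g; rewrite !rcon_lcon lcon_tmapr pid.
Qed.

(** With projections p and q onto A and B, functionals of the form f \o (id - p) and g \o (id - q)
    kill A and B. So the condition says that (id - p) ⊗ (id - q) kills t, and t splits accordingly
    as t1 + t2. *)
Lemma addtsubP A B t :
  t \in addsp (tsub A (predT : {pred W})) (tsub (predT : {pred V}) B) <->
  forall (f : {scalar V}) (g : {scalar W}),
    (forall v, v \in A -> f v = 0) -> (forall w, w \in B -> g w = 0) ->
    f (rcon g t) = 0.
Proof.
split=> [/addspP[t1 [t2 [/tsubTP At1 Bt2 ->]]] f g fA gB|H].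
  rewrite !linearD /= fA // add0r.
  have [|s sP ->] := span_sum _ Bt2.
    by move=> a _ [v [w [vA wB ->]]]; exists (a *: v), w; rewrite ptensZl.
  rewrite !linear_sum big_seq big1 // => u /sP[v [w [_ wB ->]]] /=.
  by rewrite rconE gB // scale0r linear0.
have [p [pA pid]] := ex_proj A; have [q [qB qid]] := ex_proj B.
pose t1 := tmap p idfun t; pose t2 := tmap idfun q (t - t1).
apply/addspP; exists t1, t2; split; [exact: mem_tmap|exact: mem_tmap|].
apply: bcon_eq => f g; rewrite !linearD /= rcon_tmapl rcon_tmapr.
have E : f (rcon g t - rcon (g \o q) t) = f (p (rcon g t - rcon (g \o q) t)).
  rewrite -(rconB (h := g \- (g \o q))) //.
  apply/eqP; rewrite -subr_eq0; apply/eqP.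
  apply: (H (f \- (f \o p)) (g \- (g \o q))) => [v vA|w wB] /=.
    by rewrite pid // subrr.
  by rewrite qid // subrr.
move: E; rewrite !linearB /= /t1 rcon_tmapl => E.
by rewrite -[LHS](subrK (f (rcon (g \o q) t))) E -addrA [- _ + _]addrC.
Qed.

End TensorSubspaces.

(** * Operators and simple stable subspaces *)

Lemma mem_spanE (k : fieldType) (V : lmodType k) (P : V -> Prop) v :
  P 0 -> (forall a u w, P u -> P w -> P (a *: u + w)) ->
  v \in span P <-> P v.
Proof.
move=> P0 PD; split=> [/asboolP[s [sP ->]]|]; last exact: mem_span.
elim: s sP => [|p s IHs] sP; first by rewrite big_nil.
rewrite big_cons; apply: PD; first exact/sP/mem_head.
by apply: IHs => q qs; apply: sP; rewrite inE qs orbT.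
Qed.

Lemma mem_sumsp (k : fieldType) (V : lmodType k) (P : submodClosed V -> Prop)
  (A : submodClosed V) v : P A -> v \in A -> v \in sumsp P.
Proof. by move=> PA vA; apply: mem_span; exists A. Qed.

Lemma sumsp_sum (k : fieldType) (V : lmodType k) (P : submodClosed V -> Prop) v
  :
  v \in sumsp P -> exists2 s : seq V,
    forall u, u \in s -> exists2 A, P A & u \in A & v = \sum_(u <- s) u.
Proof.
by apply: span_sum => a u [A PA uA]; exists A => //; apply: rpredZ.
Qed.

Section Operators.
Variables (k : fieldType) (A : Type).

Section Stable.
Variables (V : lmodType k) (T : A -> {linear V -> V}).
Implicit Types N X S : submodClosed V.

Definition stable N := forall a v, v \in N -> T a v \in N.

Definition simple_stable N :=
  [/\ stable N, exists2 x, x \in N & x != 0 &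
      forall N', stable N' -> {subset N' <= N} ->
        (forall x, x \in N' -> x = 0) \/ {subset N <= N'}].

Lemma stable_span (P : V -> Prop) :
  (forall a v, P v -> T a v \in span P) -> stable (span P).
Proof.
move=> PT a v /asboolP[s [sP ->]]; rewrite linear_sum big_seq.
apply: rpred_sum => p ps; rewrite linearZ; apply: rpredZ.
exact/PT/sP.
Qed.

Lemma stable_addsp N X : stable N -> stable X -> stable (addsp N X).
Proof.
move=> sN sX; apply: stable_span => a v [vN|vX]; apply: mem_span.
  by left; apply: sN.
by right; apply: sX.
Qed.

Lemma stable_sumsp (P : submodClosed V -> Prop) :
  (forall N, P N -> stable N) -> stable (sumsp P).
Proof.
move=> sP; apply: stable_span => a v [N PN vN]; apply: mem_sumsp (PN) _.
exact: sP.
Qed.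

Definition capsp N X : submodClosed V := span (fun v => v \in N /\ v \in X).

Lemma capspP N X v : v \in capsp N X <-> v \in N /\ v \in X.
Proof.
apply: mem_spanE; first by rewrite !rpred0.
by move=> a u w [uN uX] [wN wX]; split; apply: rpredD => //; apply: rpredZ.
Qed.

Lemma stable_capsp N X : stable N -> stable X -> stable (capsp N X).
Proof.
move=> sN sX; apply: stable_span => a v [vN vX]; apply: mem_span.
by split; [apply: sN|apply: sX].
Qed.

Lemma simple_meet N X : simple_stable N -> stable X ->
  (forall x, x \in N -> x \in X -> x = 0) \/ {subset N <= X}.
Proof.
move=> [sN _ Nmin] sX; have [|x /capspP[]//|H|H] := Nmin (capsp N X).
- exact: stable_capsp.
- by left=> x xN xX; apply/H/capspP.
- by right=> x /H /capspP[].
Qed.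

(* [capsp X (S + N)] is the image of S under the projection of X + N onto X. *)
Lemma simple_proj X N S : stable X -> simple_stable N -> simple_stable S ->
  {subset S <= addsp X N} -> (forall x, x \in X -> x \in N -> x = 0) ->
  (forall x, x \in capsp X (addsp S N) -> x = 0) \/
  simple_stable (capsp X (addsp S N)).
Proof.
move=> sX simN simS SXN XN0; have [sN _ _] := simN; have [sS _ _] := simS.
have [H|/existsNP[x /not_implyP[xP x0]]] :=
  EM (forall x, x \in capsp X (addsp S N) -> x = 0); [by left|right; split].
- by apply: stable_capsp => //; apply: stable_addsp.
- by exists x => //; apply/eqP.
move=> Y sY YP; have [SY|SY] := simple_meet simS (stable_addsp sY sN).
  left=> y yY; have /capspP[yX /addspP[s [n [sS' nN yE]]]] := YP _ yY.
  have sE : s = y - n by rewrite yE addrK.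
  have s0 : s = 0.
    apply: SY => //; apply/addspP; exists y, (- n); split=> //.
    exact: submodN.
  by apply: XN0 => //; rewrite yE s0 add0r.
right=> y /capspP[yX /addspP[s [n [/SY /addspP[t [n' [tY n'N ->]]] nN yE]]]].
have tX : t \in X by have /YP/capspP[] := tY.
suff /eqP : y - t = 0 by rewrite subr_eq0 => /eqP->.
apply: XN0; first exact: submodB.
by rewrite yE addrAC [t + n']addrC addrK rpredD.
Qed.

(** A stable subspace of a semisimple space is semisimple. The induction is on the number of
    summands of x, for all X at once: if the simple N containing the summand u lies in X, u is
    subtracted; otherwise X and N are independent, x - u is decomposed inside X + N, and the simple
    pieces are projected back to X along N. *)
Lemma socle_sub X x : stable X -> x \in X -> x \in sumsp simple_stable ->
  x \in sumsp (fun N => simple_stable N /\ {subset N <= X}).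
Proof.
move=> sX xX /sumsp_sum[s sP xE].
elim: s X x sX xX xE sP => [|u s IHs] X x sX xX xE sP.
  by rewrite xE big_nil rpred0.
have [N simN uN] := sP u (mem_head _ _); have [sN _ _] := simN.
have {}sP v : v \in s -> exists2 N, simple_stable N & v \in N.
  by move=> vs; apply: sP; rewrite inE vs orbT.
have {}xE : x - u = \sum_(v <- s) v by rewrite xE big_cons addrAC subrr add0r.
have [NX0|NX] := simple_meet simN sX; last first.
  rewrite -(subrK u x) rpredD //; first by apply: IHs => //;
    exact: submodB xX (NX _ uN).
  by apply: mem_sumsp uN.
have xu : x - u \in addsp X N.
  by apply/addspP; exists x, (- u); rewrite submodN.
have /sumsp_sum[r rP xuE] := IHs _ _ (stable_addsp sX sN) xu xE sP.
set Y := sumsp _; have [z [zY xzN]] : exists z, z \in Y /\ x - u - z \in N.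
  rewrite xuE; elim: r rP {xuE} => [|v r IHr] rP.
    by exists 0; rewrite big_nil subr0 !rpred0.
  have [|z [zY zN]] := IHr; first by move=> w wr; apply: rP;
    rewrite inE wr orbT.
  have [S [simS SXN] vS] := rP v (mem_head _ _).
  have /addspP[y [n [yX nN vE]]] := SXN _ vS.
  have yP : y \in capsp X (addsp S N).
    apply/capspP; split=> //; apply/addspP; exists v, (- n).
    by split; [|exact: submodN|rewrite vE addrK].
  exists (y + z); rewrite big_cons opprD addrACA vE [y + n]addrC addrK.
  split; last exact: rpredD.
  apply: rpredD => //.
  have [H|simP] := simple_proj sX simN simS SXN (fun x xX xN => NX0 x xN xX).
    by rewrite (H y yP) rpred0.
  by apply: mem_sumsp yP; split=> // w /capspP[].
suff /eqP : x - z = 0 by rewrite subr_eq0 => /eqP->.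
have zX : z \in X.
  have /sumsp_sum[q qP ->] := zY; rewrite big_seq; apply: rpred_sum => v /qP.
  by move=> [S [_ SX] /SX].
apply: NX0; last exact: submodB.
by rewrite -(subrK u (x - z)); apply: rpredD => //; rewrite addrAC.
Qed.

(** The length of a spanning list stands in for the dimension. If f kills X but not y, it is nonzero
    on some v in s, and u - (f u / f v) *: v is a linear map that fixes X and kills v. *)
Lemma proper_span N X (s : seq V) y :
  {subset X <= N} -> {subset N <= span (fun v => v \in s)} ->
  y \in N -> y \notin X ->
  exists2 s' : seq V, (size s' < size s)%N & {subset X <= span (fun v => v \in
    s')}.
Proof.
move=> XN Ns yN yX.
have [f [fX fy]] : exists f : {scalar V}, (forall x, x \in X -> f x = 0) /\ f y
  <> 0.
  apply: contrapT => H; case/negP: yX; apply/annihP => f fX.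
  by apply: contrapT => fy; apply: H; exists f.
have [v [vs fv]] : exists v, v \in s /\ f v <> 0.
  apply: contrapT => H; apply: fy; have /asboolP[r [rP ->]] := Ns _ yN.
  rewrite linear_sum big_seq big1 // => p /rP ps; rewrite linearZ /=.
  rewrite (_ : f p.2 = 0) ?mulr0 //; apply: contrapT => fp; apply: H.
  by exists p.2.
exists [seq u - (f u / f v) *: v | u <- rem v s].
  by rewrite size_map size_rem // ltn_predL; case: (s) vs.
have [|L LE] := @ex_linear _ _ _ (fun u => u - (f u / f v) *: v).
  move=> a x z; rewrite linearP mulrDl scalerDl -mulrA -scalerA opprD.
  by rewrite addrACA -scalerBr.
move=> x xX; have -> : x = L x by rewrite LE fX // mul0r scale0r subr0.
have /Ns : x \in N by apply: XN.
apply: (@span_sub _ _ _ (preimsp L _)) => u us; rewrite preimspP LE.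
have [->|uv] := eqVneq u v.
  by rewrite divff ?scale1r ?subrr ?rpred0 //; apply/eqP.
apply: mem_span; apply: map_f.
by have := perm_mem (perm_to_rem vs) u; rewrite us inE (negPf uv) => /esym.
Qed.

Lemma ex_simple N (s : seq V) : stable N -> {subset N <= span (fun v => v \in
  s)} ->
  (exists2 x, x \in N & x != 0) ->
  exists2 S, simple_stable S & {subset S <= N}.
Proof.
have [n] := ubnP (size s); elim: n s N => // n IHn s N sn sN Ns N0.
have [simN|nsimN] := EM (simple_stable N); first by exists N.
have [X [sX XN [[x xX x0] [y yN yX]]]] : exists X, [/\ stable X, {subset X <=
  N} &
    (exists2 x, x \in X & x != 0) /\ (exists2 y, y \in N & y \notin X)].
  apply: contrapT => H; apply: nsimN; split=> // X sX XN.
  have [X0|X0] := EM (forall x, x \in X -> x = 0); [by left|right].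
  move=> y yN; apply: contrapT => /negP yX; apply: H; exists X; split=> //.
  split; last by exists y.
  by have /existsNP[x /not_implyP[xX /eqP x0]] := X0; exists x.
have [s' s's Xs'] := proper_span XN Ns yN yX.
have [||S simS SX] := IHn s' X _ sX Xs'.
- by apply: leq_trans s's _.
- by exists x.
by exists S => // z /SX/XN.
Qed.

End Stable.

Lemma simple_imsp (V W : lmodType k) (T : A -> {linear V -> V})
    (T' : A -> {linear W -> W}) (f : {linear V -> W}) N :
  (forall a v, f (T a v) = T' a (f v)) -> simple_stable T N ->
  (forall v, v \in N -> f v = 0) \/ simple_stable T' (imsp f N).
Proof.
move=> fT [sN _ Nmin].
have [H|/existsNP[x /not_implyP[xN fx0]]] := EM (forall v, v \in N -> f v = 0).
  by left.
right; split.
- move=> a _ /imspP[v vN ->]; rewrite -fT; apply/imspP; exists (T a v) => //.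
  exact: sN.
- by exists (f x); [apply/imspP; exists x|apply/eqP].
move=> Y sY YN; have [||H|H] := Nmin (capsp N (preimsp f Y)).
- apply: stable_capsp => // a v; rewrite !preimspP fT; exact: sY.
- by move=> v /capspP[].
- left=> y yY; have /imspP[v vN yE] := YN _ yY.
  by rewrite yE [v]H ?linear0 //; apply/capspP; rewrite preimspP -yE.
- by right=> _ /imspP[v /H/capspP[_ vY] ->].
Qed.

End Operators.

(** * The action of functionals on comodules *)

Section Associator.
Variables (k : fieldType) (U V W : lmodType k).

Lemma tassoc1_bilin (w : W) : bilin (fun (u : U) (v : V) => u ⊗ₚ (v ⊗ₚ w)).
Proof.
by split=> [v a x y|u a x y]; rewrite ?ptensDl ?ptensZl ?ptensDr ?ptensZr.
Qed.

Lemma tassoc_bilin :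
  bilin (fun (t : U ⊗ V) (w : W) => tlift (fun u v => u ⊗ₚ (v ⊗ₚ w)) t).
Proof.
split=> [w|t a w w']; first exact/tlift_linear/tassoc1_bilin.
have [g gE] := ex_linear (tlift_linear (tassoc1_bilin w)).
have [g' g'E] := ex_linear (tlift_linear (tassoc1_bilin w')).
have /(_ t) : tlift (fun u v => u ⊗ₚ (v ⊗ₚ (a *: w + w'))) =1
    (fun t => a *: g t + g' t); last by rewrite gE g'E.
apply: tens_lin_eq.
- exact/tlift_linear/tassoc1_bilin.
- move=> b x y; rewrite (linearP g) (linearP g') !scalerDr !scalerA.
  by rewrite [a * b]mulrC; apply: addrACA.
- move=> u v; rewrite (etrans (gE _) (tliftE (tassoc1_bilin w) u v)).
  rewrite (etrans (g'E _) (tliftE (tassoc1_bilin w') u v)).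
  rewrite -(ptens_bilin _ _).2 -(ptens_bilin _ _).2.
  exact: tliftE (tassoc1_bilin _) u v.
Qed.

Lemma tassoc_linear : linear (@tassoc k U V W).
Proof. exact: (tlift_linear tassoc_bilin). Qed.

Lemma tassocE (u : U) (v : V) (w : W) :
  tassoc ((u ⊗ₚ v) ⊗ₚ w) = u ⊗ₚ (v ⊗ₚ w).
Proof. by rewrite /tassoc (tliftE tassoc_bilin) (tliftE (tassoc1_bilin _)). Qed.

(** Here [f \o rcon g] is the functional f ⊗ g on V ⊗ W; such functionals suffice to separate the
    elements of U ⊗ (V ⊗ W), see [rcon2_inj]. *)
Lemma rcon_tassoc (f : {scalar V}) (g : {scalar W}) (x : (U ⊗ V) ⊗ W) :
  rcon (f \o rcon g) (tassoc x) = rcon f (rcon g x).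
Proof.
have [h hE] := ex_linear tassoc_linear; rewrite -hE.
have [s ->] := tens_sum x; rewrite !linear_sum; apply: eq_bigr => p _ /=.
have [r ->] := tens_sum p.1.
have [L LE] := ex_linear ((ptens_bilin (U ⊗ V) W).1 p.2).
rewrite -LE !linear_sum; apply: eq_bigr => q _ /=.
by rewrite LE hE tassocE !rconE !linearZ /= !rconE linearZ /= scalerA mulrC.
Qed.

Lemma rcon2_inj (x y : U ⊗ (V ⊗ W)) :
  (forall (f : {scalar V}) (g : {scalar W}), rcon (f \o rcon g) x = rcon (f \o
    rcon g) y) -> x = y.
Proof.
move=> H; apply/eqP; rewrite -subr_eq0; apply/eqP/lcon_inj => h.
apply: bcon_inj => f g.
rewrite -[LHS](rcon_lcon h (f \o rcon g : {scalar V ⊗ W})).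
by rewrite linearB /= H subrr linear0.
Qed.

End Associator.

Section Action.
Variables (k : fieldType) (C : precoalg k).

Definition regc : precomod C := Precomod (@comul k C).

Definition act (M : precomod C) (f : {scalar C}) (m : M) : M := rcon f (coact
  m).

Arguments act : simpl never.

Lemma act_linear (M : precomod C) (f : {scalar C}) : linear (@act M f).
Proof. by move=> a u v; rewrite /act linearP rcon_linear. Qed.
HB.instance Definition _ (M : precomod C) (f : {scalar C}) :=
  GRing.isLinear.Build k _ _ _ (@act M f) (@act_linear M f).

Definition actl (M : precomod C) (f : {scalar C}) : {linear M -> M} := @act M f.

Lemma actE (M : precomod C) f (m : M) : act f m = rcon f (coact m).
Proof. by []. Qed.

Definition cact (f : {scalar C}) (c : C) : C := rcon f (comul c).

Arguments cact : simpl never.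

HB.instance Definition _ (f : {scalar C}) :=
  GRing.isLinear.Build k _ _ _ (cact f) (@act_linear regc f).

Lemma cactE f c : cact f c = rcon f (comul c).
Proof. by []. Qed.

(** The convolution product f(c_1) g(c_2) in Sweedler notation. *)
Definition conv (f g : {scalar C}) : {scalar C} := f \o cact g.

Lemma convE f g c : conv f g c = f (cact g c).
Proof. by []. Qed.

(** Contracting coassociativity by all f ⊗ g gives the axioms of a unital left module over the
    convolution algebra. *)
Lemma comodP (M : precomod C) : is_comod M <->
  (forall f g (m : M), act f (act g m) = act (conv f g) m) /\
  (forall m : M, act counit m = m).
Proof.
split=> -[H1 H2]; split=> [|m].
- move=> f g m; have := congr1 (rcon (f \o rcon g)) (H1 m).
  rewrite rcon_tassoc rcon_tmapl rcon_tmapr !actE => ->.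
  exact: rcon_fun_eq.
- by rewrite actE -rcon_tlift H2.
- move=> m; apply: rcon2_inj => f g.
  rewrite rcon_tassoc rcon_tmapl rcon_tmapr -!actE H1.
  exact: rcon_fun_eq.
- by rewrite (rcon_tlift counit) -actE H2.
Qed.

Lemma coalgP : is_coalg C <->
  [/\ forall f g c, cact f (cact g c) = cact (conv f g) c,
      forall f c, counit (cact f c) = f c & forall c, cact counit c = c].
Proof.
split=> -[H1 H2 H3].
  have /comodP[H4 H5] : is_comod regc by split.
  split=> // f c; rewrite cactE rcon_lcon -lcon_tlift.
  by congr (f _); apply: H2.
have [H4 H5] : is_comod regc by apply/comodP; split.
split=> // c; rewrite (lcon_tlift counit).
apply/eqP; rewrite -subr_eq0; apply/eqP/scalar_sep => f.
by rewrite linearB /= -rcon_lcon -cactE H2 subrr.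
Qed.

Lemma subcomodP (M : precomod C) (N : submodClosed M) :
  is_subcomod N <-> stable (actl M) N.
Proof.
split=> [H f m /H mN|H m mN]; first by apply: ((tsubTP _ _).1 mN f).
apply/tsubTP => f.
exact: (H f).
Qed.

Lemma simple_subcomodP (M : precomod C) (N : submodClosed M) :
  simple_subcomod N <-> simple_stable (actl M) N.
Proof.
split=> -[/subcomodP H1 H2 H3]; split=> // N' /subcomodP; exact: H3.
Qed.

Lemma homP (M N : precomod C) (f : {linear M -> N}) :
  is_hom f <-> forall g m, f (act g m) = act g (f m).
Proof.
split=> [H g m|H m]; first by rewrite [RHS]actE H rcon_tmapl.
by apply: rcon_eq => g; rewrite rcon_tmapl -!actE H.
Qed.

Lemma subcoalgP (D : submodClosed C) : is_subcoalg D <->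
  (forall f c, c \in D -> cact f c \in D) /\
  (forall f c, c \in D -> lcon f (comul c) \in D).
Proof.
split=> [H|[H1 H2] c cD]; last first.
  by apply/tsubP; split=> f; [apply: H1|apply: H2].
split=> f c /H/tsubP[H1 H2]; [exact: H1|exact: H2].
Qed.

End Action.

Arguments act : simpl never.
Arguments cact : simpl never.

(** * Quotients and coefficients *)

Lemma the_linearP (k : fieldType) (V W : lmodType k)
  (P : {linear V -> W} -> Prop) : (exists f, P f) -> P (the_linear P).
Proof.
by move=> H; rewrite /the_linear; case: pselect => // h; case: (cid h).
Qed.

Lemma ex_quot (k : fieldType) (V W : lmodType k) (A : submodClosed V)
    (f : {linear V -> W}) : (forall v, v \in A -> f v = 0) ->
  exists g : {linear quotsp A -> W}, forall v, g (quotsp_pi A v) = f v.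
Proof.
move=> fA; have fE u v : quotsp_pi A u = quotsp_pi A v -> f u = f v.
  move=> /quotsp_piP/fA; rewrite linearB => /eqP.
  by rewrite subr_eq0 => /eqP.
have /choice[r rE] (x : quotsp A) : exists v, quotsp_pi A v = x.
  by exists (repr x); apply: quotsp_surj.
have [|g gE] := @ex_linear _ (quotsp A) W (f \o r).
  move=> a x y /=; rewrite -linearP; apply: fE.
  by rewrite rE [RHS]linearP /= !rE.
by exists g => v; rewrite gE; apply: fE; rewrite rE.
Qed.

Lemma quotsp_pi_eq0 (k : fieldType) (V : lmodType k) (A : submodClosed V) v :
  quotsp_pi A v = 0 <-> v \in A.
Proof. by rewrite -(linear0 (quotsp_pi A)) quotsp_piP subr0. Qed.

Section Quotient.
Variables (k : fieldType) (C : precoalg k) (M : precomod C) (N : submodClosed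
  M).
Hypotheses (HM : is_comod M) (sN : stable (actl M) N).

Lemma quot_coact (m : M) : coact (quotsp_pi N m : quot_comod N) =
  tmap (quotsp_pi N) id (coact m).
Proof.
pose P (r : {linear quotsp N -> quotsp N ⊗ C}) :=
  forall m : M, r (quotsp_pi N m) = tmap (quotsp_pi N) id (coact m).
apply: (@the_linearP _ _ _ P) => {m}.
have [|g gE] := @ex_quot _ _ _ N (tmap (quotsp_pi N) idfun \o coact).
  move=> m mN; apply: rcon_inj => f.
  by rewrite /= rcon_tmapl; apply/quotsp_pi_eq0/(sN f).
by exists g.
Qed.

Lemma quot_act (f : {scalar C}) (m : M) :
  @act _ _ (quot_comod N) f (quotsp_pi N m) = quotsp_pi N (act f m).
Proof. by rewrite actE quot_coact rcon_tmapl. Qed.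

Lemma quot_comodP : is_comod (quot_comod N).
Proof.
have [H1 H2] := (comodP M).1 HM.
apply/comodP; split=> [f g x|x].
  by rewrite -(quotsp_surj x) !quot_act H1.
by rewrite -(quotsp_surj x) quot_act H2.
Qed.

End Quotient.

Section Coefficients.
Variables (k : fieldType) (C : precoalg k) (M : precomod C).
Hypotheses (HC : is_coalg C) (HM : is_comod M).

Definition coef (f : {scalar M}) (m : M) : C := lcon f (coact m).

Arguments coef : simpl never.

Lemma coef_linear (f : {scalar M}) : linear (coef f).
Proof. by move=> a u v; rewrite /coef linearP lcon_linear. Qed.
HB.instance Definition _ (f : {scalar M}) :=
  GRing.isLinear.Build k _ _ _ (coef f) (coef_linear f).

Lemma coef_eval (f : {scalar M}) (g : {scalar C}) (m : M) : g (coef f m) = f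
  (act g m).
Proof. by rewrite actE rcon_lcon. Qed.

(** This makes [coef f] a homomorphism from M to the comodule C; it is the only source of such maps
    below. *)
Lemma coef_act (f : {scalar M}) (g : {scalar C}) (m : M) : cact g (coef f m) =
  coef f (act g m).
Proof.
apply/eqP; rewrite -subr_eq0; apply/eqP/scalar_sep => h.
rewrite linearB /= -convE !coef_eval.
by rewrite ((comodP M).1 HM).1 subrr.
Qed.

Lemma coef_lcon (f : {scalar M}) (g : {scalar C}) (m : M) : lcon g (comul (coef
  f m)) = coef (f \o act g) m.
Proof.
apply/eqP; rewrite -subr_eq0; apply/eqP/scalar_sep => h.
rewrite linearB /= -rcon_lcon -cactE -convE !coef_eval /=.
by rewrite ((comodP M).1 HM).1 subrr.
Qed.

Definition coefsp (N : submodClosed M) : submodClosed C :=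
  span (fun c => exists (f : {scalar M}) x, x \in N /\ c = coef f x).

Lemma mem_coefsp (N : submodClosed M) (f : {scalar M}) x : x \in N -> coef f x
  \in coefsp N.
Proof. by move=> xN; apply: mem_span; exists f, x. Qed.

Lemma coefsp_subcoalg (N : submodClosed M) : stable (actl M) N ->
  is_subcoalg (coefsp N).
Proof.
move=> sN; apply/subcoalgP; split=> f c cN.
  apply: (@stable_span _ _ _ (@cact _ C)) cN => {}f _ [g [x [xN ->]]].
  by rewrite /= coef_act; apply: mem_coefsp; apply: sN.
apply: (@stable_span _ _ _ (fun f => (lcon f \o comul : {linear C -> C}))) cN.
move=> {}f _ [g [x [xN ->]]] /=.
by rewrite coef_lcon; apply: mem_coefsp.
Qed.

Lemma coefsp_neq0 (N : submodClosed M) : (exists2 x, x \in N & x != 0) ->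
  exists2 x, x \in coefsp N & x != 0.
Proof.
move=> [x xN /ex_scalar1[f fx]]; exists (coef f x); first exact: mem_coefsp.
apply/eqP => cx; have := coef_eval f counit x.
rewrite cx linear0 ((comodP M).1 HM).2 fx => /esym/eqP.
by rewrite oner_eq0.
Qed.

Definition ann (D : submodClosed C) (f : {scalar C}) :=
  forall c, c \in D -> f c = 0.

Lemma subcoalg_cact0 (D : submodClosed C) (f : {scalar C}) c : is_subcoalg D ->
  ann D f ->
  c \in D -> cact f c = 0.
Proof.
move=> /subcoalgP[_ H] fD cD; apply: scalar_sep => g.
by rewrite cactE rcon_lcon fD //; apply: H.
Qed.

(* If ann D' does not kill N, then by simplicity it acts on every x in N as the
   identity does; this shortens each expression of an element of D' as a sum of
   coefficients of N. *)
Lemma coefsp_simple (N : submodClosed M) : simple_stable (actl M) N ->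
  simple_subcoalg (coefsp N).
Proof.
have [actA act1] := (comodP M).1 HM.
move=> [sN N0 Nmin]; split; [exact: coefsp_subcoalg|exact: coefsp_neq0|].
move=> D sD DN; have [DN1 DN2] := (subcoalgP D).1 sD.
pose K : submodClosed M :=
  span (fun x => x \in N /\ forall f, ann D f -> act f x = 0).
have KP x : x \in K <-> x \in N /\ forall f, ann D f -> act f x = 0.
  apply: mem_spanE => [|a u v [uN uJ] [vN vJ]].
    by split=> [|f _]; rewrite ?rpred0 ?linear0.
  split=> [|f fD]; first by rewrite rpredD ?rpredZ.
  by rewrite linearP /= uJ // vJ // scaler0 addr0.
have [||K0|NK] := Nmin K.
- apply: stable_span => f x [xN xJ]; apply/KP; split; first exact: sN.
  move=> g gD; rewrite actA; apply: xJ => c cD.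
  by rewrite convE gD //; apply: DN1.
- by move=> x /KP[].
- left=> d dD; have /span_sum[a _ [f [x [xN ->]]]|r rP dE] := DN _ dD.
    by exists f, (a *: x); rewrite rpredZ ?linearZ.
  have [n] := ubnP (size r).
  elim: n r d dD dE rP => // n IHn [|c r] d dD dE rP sz.
    by rewrite dE big_nil.
  have [f [x [xN cE]]] := rP c (mem_head _ _).
  have {}rP u : u \in r -> exists (f : {scalar M}) x, x \in N /\ u = coef f x.
    by move=> ur; apply: rP; rewrite inE ur orbT.
  have [x0|x0] := eqVneq x 0.
    by apply: (IHn r) => //; rewrite dE big_cons cE x0 linear0 add0r.
  pose X : submodClosed M := span (fun u => exists2 g, ann D g & u = act g x).
  have XP u : u \in X <-> exists2 g, ann D g & u = act g x.
    apply: mem_spanE => [|a _ _ [g gD ->] [h hD ->]].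
      by exists \0 => [c' _ //|]; rewrite /act (@rconB _ _ _ \0 \0 \0) ?subrr
        //= => w; rewrite subr0.
    have [|l lE] := @ex_scalar _ _ (fun c => a * g c + h c).
      by move=> b y z; rewrite !linearP /= !mulrDr addrACA !mulrA [a * b]mulrC.
    exists l; first by move=> c' cD; rewrite lE gD // hD // mulr0 addr0.
    by rewrite /act -(rconP _ lE).
  have [||X0|NX] := Nmin X.
  + apply: stable_span => h _ [g gD ->]; apply/XP; exists (conv h g).
      by move=> c' cD; rewrite convE (subcoalg_cact0 _ gD) ?linear0.
    by rewrite /= actA.
  + by move=> u /XP[g _ ->]; apply: sN.
  + case/eqP: x0; apply: K0; apply/KP; split=> // g gD.
    by apply: X0; apply/XP; exists g.
  have /XP[g gD xE] := NX _ xN.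
  apply: (IHn [seq u - cact g u | u <- r]) => //.
  + have -> : d = d - cact g d by rewrite (subcoalg_cact0 sD gD dD) subr0.
    rewrite dE big_map linear_sum -sumrB big_cons /= cE coef_act -xE.
    by rewrite subrr add0r.
  + move=> _ /mapP[u /rP[h [y [yN ->]]] ->]; exists h, (y - act g y).
    by rewrite submodB ?sN // linearB coef_act.
  + by rewrite size_map.
- right; apply: span_sub => _ [f [x [xN ->]]]; apply/annihP => g gD.
  rewrite coef_eval; have /KP[_ ->] := NK _ xN; last exact: gD.
  by rewrite linear0.
Qed.

End Coefficients.

(** * The Loewy series *)

Section Socle.
Variables (k : fieldType) (C : precoalg k).
Hypothesis HC : is_coalg C.

Lemma regc_comod : is_comod (regc C).
Proof. by have [H1 _ H3] := HC. Qed.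

(** Local finiteness: the subcomodule generated by x lies in the span of the left factors of any
    expression of its coaction, so [ex_simple] applies to it. *)
Lemma comod_ex_simple (M : precomod C) (X : submodClosed M) : is_comod M ->
  stable (actl M) X -> (exists2 x, x \in X & x != 0) ->
  exists2 S, simple_stable (actl M) S & {subset S <= X}.
Proof.
move=> /comodP[actA act1] sX [x xX x0].
pose N : submodClosed M := span (fun u => exists f, u = act f x).
have [s sE] := tens_sum (coact x).
have [||| S simS SN] := @ex_simple _ _ _ (actl M) N [seq p.1 | p <- s].
- apply: stable_span => f _ [g ->]; apply: mem_span; exists (conv f g).
  by rewrite -actA.
- apply: span_sub => _ [f ->]; rewrite actE sE linear_sum big_seq.
  apply: rpred_sum => p ps /=; rewrite rconE; apply: rpredZ.
  by apply: mem_span; apply: map_f.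
- by exists x => //; apply: mem_span; exists counit; rewrite act1.
exists S => // u /SN; apply: span_sub => _ [f ->]; exact: (sX f).
Qed.

(** A simple subcoalgebra D contains a simple right subcomodule S of C. The coefficients of S form a
    nonzero subcoalgebra of D, hence all of D, and each [coef f] maps S to zero or to a simple
    subcomodule. *)
Lemma coradical_socle c : c \in coradical C -> c \in sumsp (simple_stable (actl
  (regc C))).
Proof.
apply: span_sub => {}c [D [sD D0 Dmin] cD].
have [D1 D2] := (subcoalgP D).1 sD.
have [//|S simS SD] := @comod_ex_simple (regc C) D regc_comod _ D0.
have [sS S0 _] := simS.
have [|x xD|H|DS] := Dmin (coefsp S).
- exact: (coefsp_subcoalg regc_comod sS).
- by move: xD; apply: span_sub => _ [f [x' [x'S ->]]]; apply/D2/SD.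
- have [x /H-> /eqP//] := coefsp_neq0 regc_comod S0.
have := DS _ cD; apply: span_sub => _ [f [x [xS ->]]].
have [//|H|H] := @simple_imsp _ _ _ _ (actl (regc C)) (actl (regc C)) (coef f)
  S _ simS.
- by move=> g v; rewrite /= -coef_act //; apply: regc_comod.
- by rewrite H // rpred0.
by apply: mem_sumsp H _; apply/imspP; exists x.
Qed.

Section SocleComod.
Variables (M : precomod C).
Hypothesis HM : is_comod M.

Lemma socle_stable : stable (actl M) (socle M).
Proof. by apply: stable_sumsp => N /simple_subcomodP[]. Qed.

Lemma simple_act0 (N : submodClosed M) x f : simple_stable (actl M) N ->
  x \in N -> ann (coradical C) f -> act f x = 0.
Proof.
move=> simN xN fC; apply: scalar_sep => g; rewrite -coef_eval; apply: fC.
by apply: mem_sumsp (coefsp_simple HM simN) _; apply: mem_coefsp.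
Qed.

(** The action on the cofree comodule M ⊗ C, with coaction id ⊗ Δ; by [coact_act] the coaction of M
    is equivariant for it. *)
Definition tens_act (f : {scalar C}) : {linear M ⊗ C -> M ⊗ C} :=
  tmap idfun (cact f).

Lemma coact_act f (m : M) : coact (act f m) = tens_act f (coact m).
Proof.
have [actA _] := (comodP M).1 HM.
by apply: rcon_eq => g; rewrite rcon_tmapr -!actE actA.
Qed.

Lemma socleP (m : M) :
  m \in socle M <-> forall f, ann (coradical C) f -> act f m = 0.
Proof.
have [actA act1] := (comodP M).1 HM.
have coactK x : rcon counit (coact x) = x := act1 x.
split=> [/sumsp_sum[s sP ->] f fC|H].
  rewrite linear_sum big_seq big1 // => u /sP[N /simple_subcomodP simN uN].
  exact: simple_act0 uN fC.
have: coact m \in tsub (predT : {pred M}) (coradical C).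
  apply/tsubTrP => g; apply/annihP => f fC.
  by rewrite -rcon_lcon -actE H // linear0.
pose X := imsp coact (span (fun _ : M => True)).
have XP x : coact x \in X by apply/imspP; exists x => //; apply: mem_span.
have sX : stable tens_act X.
  by move=> f _ /imspP[x _ ->]; rewrite -coact_act.
have tsoc : {subset tsub (predT : {pred M}) (coradical C) <=
    sumsp (simple_stable tens_act)}.
  apply: span_sub => _ [v [c [_ /coradical_socle cC ->]]].
  have [L LE] := ex_linear ((ptens_bilin M C).2 v).
  have /sumsp_sum[s sP ->] := cC; rewrite -LE linear_sum big_seq.
  apply: rpred_sum => u /sP[S simS uS].
  have [|L0|simL] := @simple_imsp _ _ _ _ (actl (regc C)) tens_act L S _ simS.
  - by move=> f c'; rewrite !LE [RHS]tmapE.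
  - by rewrite L0 // rpred0.
  by apply: mem_sumsp simL _; apply/imspP; exists u.
(* [socle_sub] keeps the simple summands inside the image of the coaction, so they can be pulled
   back to M, where contraction by the counit inverts the coaction. *)
move=> /tsoc/(socle_sub sX (XP m))/sumsp_sum[s sP mE].
rewrite -(coactK m) mE linear_sum big_seq;
  apply: rpred_sum => u /sP[S [simS SX] uS].
have [sS [y yS y0] Smin] := simS.
apply: (@mem_sumsp _ _ _ (preimsp coact S)); last first.
  by have /SX/imspP[x _ xE] := uS; rewrite preimspP /= xE coactK -xE.
apply/simple_subcomodP; split.
- by move=> f x; rewrite !preimspP /= coact_act; apply: sS.
- have /SX/imspP[x _ xE] := yS; exists x; first by rewrite preimspP -xE.
  by apply: contraNneq y0 => x0; rewrite xE x0 linear0.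
move=> Y sY YS; have [||H'|H'] := Smin (imsp coact Y).
- move=> f _ /imspP[x xY ->]; apply/imspP; exists (act f x);
  first exact: (sY f).
  by rewrite coact_act.
- by move=> _ /imspP[x /YS xS ->].
- left=> x xY; rewrite -(coactK x) (H' (coact x)) ?linear0 //.
  by apply/imspP; exists x.
- right=> x; rewrite preimspP => /H'/imspP[z zY /(congr1 (rcon counit))].
  by rewrite !coactK => ->.
Qed.

End SocleComod.

Lemma coradfSP n c : c \in coradf C n.+1 <->
  forall f g, ann (coradf C n) f -> ann (coradical C) g -> conv f g c = 0.
Proof.
rewrite /= preimspP; split=> [/addtsubP H f g fC gC|H]; first exact: H.
by apply/addtsubP => f g fC gC; apply: H.
Qed.

(** By induction m is in M_(n+1) exactly when (C_0)^perp m lies in M_n, that is, when the products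
    of (C_n)^perp and (C_0)^perp kill m; equivalently, all coefficients of m lie in C_(n+1).
    Stability of M_n is carried along because the coaction of the quotient is determined only for
    stable subspaces. *)
Lemma loewyP (M : precomod C) : is_comod M -> forall n (m : M),
  m \in loewy M n <-> forall f, ann (coradf C n) f -> act f m = 0.
Proof.
move=> HM; have [actA act1] := (comodP M).1 HM.
suff H n : stable (actl M) (loewy M n) /\ forall m : M,
  m \in loewy M n <-> forall f, ann (coradf C n) f -> act f m = 0.
  by move=> n; case: (H n).
elim: n => [|n [sn IHn]]; first by split; [exact: socle_stable|exact: socleP].
have HQ := quot_comodP HM sn.
split=> [f m|m].
  by move=> /(@socle_stable (quot_comod (loewy M n)) f); rewrite /= quot_act.
rewrite /= preimspP; split=> [/(socleP HQ) H h hC|H].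
  apply: scalar_sep => g; rewrite -coef_eval; apply: hC;
    apply/coradfSP => e f eC fC.
  rewrite coef_eval -actA (IHn _).1 ?linear0 //.
  by apply/quotsp_pi_eq0; rewrite -quot_act // H.
apply/(socleP HQ) => f fC; rewrite quot_act //; apply/quotsp_pi_eq0/IHn => e eC.
rewrite actA; apply: H => c /coradfSP; exact.
Qed.

End Socle.

(** * Filtrations *)

Lemma prevf_subset (k : fieldType) (V : lmodType k) (F : nat -> submodClosed V)
  i j :
  (forall n, {subset F n <= F n.+1}) -> (i <= j)%N ->
  {subset prevf F i <= prevf F j}.
Proof.
move=> Finc; have step n : {subset prevf F n <= prevf F n.+1}.
  by case: n => [|n] //= v /zerospP->; apply: rpred0.
move=> /subnK <-; elim: (j - i)%N => // d IHd v /IHd.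
by rewrite addSn; apply: step.
Qed.

Section Filtration.
Variables (k : fieldType) (C : precoalg k).
Hypothesis HC : is_coalg C.

(** The shift to C_(j-1) makes K 0 the whole dual and lets indices add under convolution without
    correction ([ann_conv]). *)
Notation K j := (ann (prevf (@coradf k C) j)).

Lemma conv_lcon (f g : {scalar C}) c : conv f g c = g (lcon f (comul c)).
Proof. by rewrite convE cactE rcon_lcon. Qed.

Lemma convA (f g h : {scalar C}) c : conv (conv f g) h c = conv f (conv g h) c.
Proof. by rewrite !convE; have /coalgP[-> _ _] := HC. Qed.

Lemma coradical_subcoalg : is_subcoalg (coradical C).
Proof.
apply/subcoalgP; split=> f.
  apply: (stable_sumsp (T := fun f => (cact f : {linear C -> C}))) => D.
  by move=> [/subcoalgP[H _] _ _].
apply: (stable_sumsp (T := fun f => (lcon f \o comul : {linear C -> C}))) => D.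
by move=> [/subcoalgP[_ H] _ _].
Qed.

(** Associativity moves the extra functional h onto one factor: g * h still kills C_0, and h * f
    still kills C_n. *)
Lemma coradf_subcoalg n : is_subcoalg (coradf C n).
Proof.
elim: n => [|n IHn]; first exact: coradical_subcoalg.
have [H1 H2] := (subcoalgP _).1 coradical_subcoalg.
have [I1 I2] := (subcoalgP _).1 IHn.
apply/subcoalgP; split=> h c /coradfSP cn; apply/coradfSP => f g fC gC.
  rewrite -convE convA; apply: cn => // d dC.
  by rewrite convE gC //; apply: H1.
rewrite -conv_lcon -convA; apply: cn => // d dC.
by rewrite conv_lcon fC //; apply: I2.
Qed.

Lemma coradf_cact n f c : c \in coradf C n -> cact f c \in coradf C n.
Proof. by have [H _] := (subcoalgP _).1 (@coradf_subcoalg n); apply: H. Qed.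

Lemma coradf_lcon n f c : c \in coradf C n -> lcon f (comul c) \in coradf C n.
Proof. by have [_ H] := (subcoalgP _).1 (@coradf_subcoalg n); apply: H. Qed.

Lemma coradf_inc n : {subset coradf C n <= coradf C n.+1}.
Proof.
move=> c cn; apply/coradfSP => f g fC gC; rewrite convE fC //.
exact: coradf_cact.
Qed.

Lemma ann_mono i j f : (i <= j)%N -> K j f -> K i f.
Proof. by move=> ij fK c ci; apply: fK; apply: prevf_subset ci;
  first exact: coradf_inc. Qed.

Lemma ann_convr n f g : K n f -> K n (conv f g).
Proof.
case: n => [|n] fK c; first by move=> /zerospP->; rewrite linear0.
move=> cn; rewrite convE fK //.
exact: coradf_cact.
Qed.

Lemma ann_convl n f g : K n g -> K n (conv f g).
Proof.
case: n => [|n] gK c; first by move=> /zerospP->; rewrite linear0.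
move=> cn; rewrite conv_lcon gK //.
exact: coradf_lcon.
Qed.

(** The filtration is defined by splitting off C_0 on the right only, which gives j = 1. For larger
    j, contracting c by f on the left lands in the right term of the filtration, as one sees by
    testing on products a * b with b killing C_0: the induction hypothesis applies to f * a. *)
Lemma ann_conv i j f g : K i f -> K j g -> K (i + j) (conv f g).
Proof.
case: j => [|j]; first by rewrite addn0 => fK _; apply: ann_convr.
rewrite addnS; elim: j i f g => [|j IHj] i f g fK gK.
  rewrite addn0; case: i fK => [|i] fK; first exact: ann_convl.
  by move=> c /coradfSP; apply.
rewrite addnS => c /coradfSP cn; rewrite conv_lcon; apply: gK.
apply/coradfSP => a b aK bK; rewrite -conv_lcon -convA; apply: cn => //.
exact: (IHj i).
Qed.

(** Truncated subtraction is intended: for n <= j the conclusion is that f kills c, [prevf] being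
    zero at index 0. *)
Lemma coradf_filt n j c f : c \in prevf (@coradf k C) n -> K j f ->
  cact f c \in prevf (@coradf k C) (n - j).
Proof.
move=> cn fK; apply/annihP => g gK; rewrite -convE.
by apply: (ann_mono _ (ann_conv gK fK) cn); rewrite addnC -leq_subLR.
Qed.

Lemma prevf_loewyP (M : precomod C) n (m : M) : is_comod M ->
  m \in prevf (@loewy k C M) n <-> forall f, K n f -> act f m = 0.
Proof.
move=> HM; case: n => [|n]; last exact: loewyP.
split=> [/zerospP -> f _|H]; first by rewrite linear0.
apply/zerospP; rewrite -[m]((comodP M).1 HM).2; apply: H => c /zerospP->.
by rewrite linear0.
Qed.

Lemma loewy_filt (M : precomod C) n j (m : M) f : is_comod M ->
  m \in prevf (@loewy k C M) n -> K j f ->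
  act f m \in prevf (@loewy k C M) (n - j).
Proof.
move=> HM mn fK; apply/prevf_loewyP => // g gK.
rewrite ((comodP M).1 HM).1; apply: ((prevf_loewyP _ _ HM).1 mn).
by apply: ann_mono (ann_conv gK fK); rewrite addnC -leq_subLR.
Qed.

Lemma loewy_inc (M : precomod C) n : is_comod M ->
  {subset loewy M n <= loewy M n.+1}.
Proof.
move=> HM m mn; apply/(loewyP HC HM) => f fK.
have /= := (loewyP HC HM n m).1 mn f; apply => c cn.
by apply: fK; apply: coradf_inc.
Qed.

End Filtration.

Lemma tsub_seq (k : fieldType) (V W : lmodType k) (A : submodClosed V)
    (B : submodClosed W) t : t \in tsub A B ->
  exists s : seq (subsp A * subsp B), t = \sum_(p <- s) val p.1 ⊗ₚ val p.2.
Proof.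
move=> /span_sum[a _ [v [w [vA wB ->]]]|s sP ->].
  by exists (a *: v), w; rewrite ptensZl rpredZ.
elim: s sP => [|u s IHs] sP; first by exists [::]; rewrite !big_nil.
have [|r rE] := IHs; first by move=> x xs; apply: sP; rewrite inE xs orbT.
have [v [w [vA wB uE]]] := sP u (mem_head _ _).
by exists ((Subsp vA, Subsp wB) :: r); rewrite !big_cons rE -uE.
Qed.

Section FilteredTensor.
Variables (k : fieldType) (V W : lmodType k).
Variables (F : nat -> submodClosed V) (G : nat -> submodClosed W).
Hypothesis Ginc : forall n, {subset G n <= G n.+1}.

Definition filt_tens n (t : V ⊗ W) :=
  exists s : forall i : 'I_n.+1, seq (subsp (F i) * subsp (G (n - i)%N)),
    t = \sum_(i < n.+1) \sum_(p <- s i) val p.1 ⊗ₚ val p.2.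

(* With projections q_j onto G_(j-1), the part (id ⊗ (q_(j+1) - q_j)) t lies in
   F_(n-j) ⊗ G_j; no compatibility between the q_j is needed. *)
Lemma filt_tensP n (t : V ⊗ W) :
  (forall j (f : {scalar W}), (forall w, w \in prevf G j -> f w = 0) ->
    rcon f t \in prevf F (n.+1 - j)) -> filt_tens n t.
Proof.
move=> H; have /choice[q qP] j := ex_proj (prevf G j).
pose e j : {linear W -> W} := q j.+1 \- q j.
pose T j : {linear V ⊗ W -> V ⊗ W} := tmap idfun (e j).
have TE j : (j <= n)%N -> T j t \in tsub (F (n - j)) (G j).
  move=> jn; apply/tsubP; split=> f.
    rewrite [X in X \in _](rcon_tmapr (e j)).
    have := H j (f \o e j); rewrite subSn //=; apply => w wG.
    rewrite /= (qP j).2 // (qP j.+1).2 ?subrr ?linear0 //=.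
    exact: (prevf_subset Ginc (leqnSn j) wG).
  rewrite [X in X \in _](lcon_tmapr (e j)) /= submodB //;
    first exact: (qP j.+1).1.
  by apply: (prevf_subset Ginc (leqnSn j)); apply: (qP j).1.
have tE : t = \sum_(j < n.+1) T j t.
  apply: rcon_eq => f; rewrite linear_sum /=.
  have eE j : rcon f (T j t) = rcon (f \o q j.+1) t - rcon (f \o q j) t.
    rewrite [LHS](rcon_tmapr (e j)) (@rconB _ _ _ (f \o q j.+1) (f \o q j)) //.
    by move=> w; rewrite /= linearB.
  transitivity (\sum_(0 <= j < n.+1) (rcon (f \o q j.+1) t - rcon (f \o q j)
    t)).
    rewrite telescope_sumr //.
    have -> : rcon (f \o q 0%N) t = 0.
      rewrite (@rconB _ _ _ (f \o q 0%N) (f \o q 0%N)) ?subrr // => w /=.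
      by have /zerospP-> := (qP 0%N).1 w; rewrite linear0 subr0.
    rewrite subr0; apply/eqP; rewrite -subr_eq0; apply/eqP.
    rewrite -(@rconB _ _ _ _ _ (f \- (f \o q n.+1))) //.
    (* The remainder left by q_(n+1) vanishes: at j = n.+1 the hypothesis puts the contraction in
       [prevf F 0], which is zero. *)
    apply/zerospP; have := H n.+1 (f \- (f \o q n.+1)); rewrite subnn; apply.
    by move=> w wG /=; rewrite (qP n.+1).2 // subrr.
  by rewrite big_mkord; apply: eq_bigr => j _; rewrite -eE.
have sP (i : 'I_n.+1) : exists s : seq (subsp (F i) * subsp (G (n - i)%N)),
    T (n - i)%N t = \sum_(p <- s) val p.1 ⊗ₚ val p.2.
  by apply: tsub_seq; have := TE _ (leq_subr i n); rewrite subKn // -ltnS.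
exists (fun i => projT1 (cid (sP i)));
  rewrite {1}tE (reindex_inj rev_ord_inj) /=.
apply: eq_bigr => i _; rewrite subSS; exact: projT2 (cid (sP i)).
Qed.

End FilteredTensor.

(** * Associated graded spaces *)

Section DirectSum.
Variables (k : fieldType) (V : nat -> lmodType k).

Lemma dinj_in i (v : V i) : val (dinj v) i = v.
Proof. by rewrite /= /dinj_fun dfwith_in. Qed.

Lemma dinj_out i j (v : V i) : i != j -> val (dinj v) j = 0.
Proof. by move=> ij; rewrite /= /dinj_fun dfwith_out. Qed.

Lemma dsum_eq (x y : dsum V) : (forall i, val x i = val y i) -> x = y.
Proof.
by move=> H; apply: val_inj; apply: functional_extensionality_dep.
Qed.

Lemma dsum_valP a (x y : dsum V) i :
  val (a *: x + y) i = a *: val x i + val y i.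
Proof. by []. Qed.

Lemma dinj_linear i : linear (@dinj k V i).
Proof.
move=> a u v; apply: dsum_eq => j; rewrite dsum_valP.
have [ij|ij] := eqVneq i j; first by case: j / ij; rewrite !dinj_in.
by rewrite !dinj_out // scaler0 addr0.
Qed.
HB.instance Definition _ i :=
  GRing.isLinear.Build k _ _ _ (@dinj k V i) (@dinj_linear i).

Lemma dsum_val_sum I (r : seq I) (x : I -> dsum V) i :
  val (\sum_(j <- r) x j) i = \sum_(j <- r) val (x j) i.
Proof. by elim/big_ind2: _ => // x1 y1 x2 y2 <- <-. Qed.

Lemma dsum_sum (x : dsum V) : exists n, x = \sum_(i < n) dinj (val x i).
Proof.
have /asboolP[n xn] := valP x; exists n; apply: dsum_eq => j.
rewrite dsum_val_sum.
have [jn|jn] := ltnP j n.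
  rewrite (bigD1 (Ordinal jn)) //;
    rewrite [X in _ = X + _](@dinj_in j) big1 ?addr0 // => i ij.
  rewrite dinj_out //; apply: contraNneq ij => ij.
rewrite xn // big1 // => i _; rewrite dinj_out //.
by rewrite neq_ltn (leq_trans (ltn_ord i) jn).
Qed.

Lemma dsum_lift (W : lmodType k) (g : forall i, {linear V i -> W}) :
  exists h : {linear dsum V -> W}, forall i v, h (dinj v) = g i v.
Proof.
have /choice[N NP] (x : dsum V) : exists n, forall i, (n <= i)%N -> val x i = 0.
  exact/asboolP/(valP x).
pose h x := \sum_(i < N x) g i (val x i).
have hE n (x : dsum V) : (forall i, (n <= i)%N -> val x i = 0) ->
    h x = \sum_(i < n) g i (val x i).
  move=> xn.
  have E m m' : (m <= m')%N -> (forall i, (m <= i)%N -> val x i = 0) ->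
      \sum_(i < m) g i (val x i) = \sum_(i < m') g i (val x i).
    move=> mm' xm; rewrite -!(big_mkord xpredT (fun i => g i (val x i))).
    rewrite (big_cat_nat _ mm') //= [X in _ = _ + X]big1_seq ?addr0 // => i.
    by rewrite mem_index_iota /= => /andP[mi _]; rewrite xm // linear0.
  have [nN|nN] := leqP n (N x); first by rewrite (E n (N x)).
  by rewrite /h (E _ n (ltnW nN)) //; apply: NP.
have [a x y|H HE] := @ex_linear _ _ _ h.
  pose m := maxn (N (a *: x + y)) (maxn (N x) (N y)).
  have E x' : (N x' <= m)%N -> h x' = \sum_(i < m) g i (val x' i).
    by move=> xm; apply: hE => i mi; apply: NP; apply: leq_trans mi.
  rewrite !E ?leq_max ?leqnn ?orbT // scaler_sumr -big_split.
  by apply: eq_bigr => i _; rewrite dsum_valP linearP.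
exists H => i v; rewrite HE (hE i.+1) => [|j ij]; last first.
  by rewrite dinj_out // neq_ltn ij.
rewrite big_ord_recr [X in g _ X](@dinj_in i) big1 => [|j _];
  first exact: add0r.
by rewrite dinj_out ?linear0 //= neq_ltn (ltn_ord j) orbT.
Qed.

End DirectSum.

Section GradedSpace.
Variables (k : fieldType) (V : lmodType k) (F : nat -> submodClosed V).

Lemma gr_cls_linear n : linear (@gr_cls k V F n).
Proof. by move=> a u v; rewrite -[RHS]dinj_linear; congr dinj;
  apply: linearP. Qed.
HB.instance Definition _ n :=
  GRing.isLinear.Build k _ _ _ (@gr_cls k V F n) (@gr_cls_linear n).

Lemma gr_cls_eq0 n (v : subsp (F n)) : gr_cls v = 0 <-> val v \in prevf F n.
Proof.
rewrite -[val v \in _]/(v \in preimsp (incl (F n)) (prevf F n)).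
rewrite -quotsp_pi_eq0 /gr_cls; split=> [E|->]; last exact: linear0.
by rewrite -[LHS](@dinj_in k (gr_piece F) n) E.
Qed.

(* A linear extension to V of the projection of F_n onto its class in gr. *)
Definition grpi n : {linear V -> gr F} :=
  projT1 (cid (ex_ext (@gr_cls k V F n : {linear subsp (F n) -> gr F}))).

Lemma grpi_val n (v : subsp (F n)) : grpi n (val v) = gr_cls v.
Proof. exact: (projT2 (cid (ex_ext _)) v). Qed.

Lemma grpi_cls n v (vF : v \in F n) : grpi n v = gr_cls (Subsp vF).
Proof. by rewrite -grpi_val. Qed.

Lemma grpi_eq0 n v : v \in F n -> grpi n v = 0 <-> v \in prevf F n.
Proof. by move=> vF; rewrite (grpi_cls vF) gr_cls_eq0. Qed.

Lemma gr_sum (x : gr F) : exists n (v : nat -> V),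
  (forall i, v i \in F i) /\ x = \sum_(i < n) grpi i (v i).
Proof.
have [n xE] := dsum_sum x.
pose v i : subsp (F i) := repr (val x i).
exists n, (fun i => val (v i)); split=> [i|]; first exact: valP.
rewrite {1}xE; apply: eq_bigr => i _; rewrite grpi_val /gr_cls; congr dinj.
by rewrite [RHS]quotsp_surj.
Qed.

Lemma gr_lin_eq (W : lmodType k) (f g : {linear gr F -> W}) :
  (forall n v, v \in F n -> f (grpi n v) = g (grpi n v)) -> f =1 g.
Proof.
move=> fg x; have [n [v [vF ->]]] := gr_sum x.
by rewrite !linear_sum; apply: eq_bigr => i _; apply: fg.
Qed.

Lemma gr_lift (W : lmodType k) (h : nat -> {linear V -> W}) :
  (forall n v, v \in prevf F n -> h n v = 0) ->
  exists g : {linear gr F -> W}, forall n v, v \in F n -> g (grpi n v) = h n v.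
Proof.
move=> h0; have gP i : exists g : {linear gr_piece F i -> W},
    forall v : subsp (F i), g (quotsp_pi _ v) = h i (val v).
  have [v vF|g gE] := @ex_quot _ _ _ (preimsp (incl (F i)) (prevf F i)) (h i \o
    incl (F i)).
    by apply: h0.
  by exists g.
have [g gE] := dsum_lift (fun i => projT1 (cid (gP i))).
exists g => n v vF; rewrite (grpi_cls vF) /gr_cls gE.
by rewrite (projT2 (cid (gP n))).
Qed.

Hypothesis Finc : forall n, {subset F n <= F n.+1}.

Lemma grpi_prev n v : v \in prevf F n -> grpi n v = 0.
Proof.
move=> vF; apply/grpi_eq0 => //.
exact: (prevf_subset Finc (leqnSn n) vF).
Qed.

Lemma grpi_lt i n v : v \in F i -> (i < n)%N -> grpi n v = 0.
Proof.
move=> vF i_n; apply: grpi_prev.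
exact: (@prevf_subset _ _ F i.+1 n Finc i_n v vF).
Qed.

End GradedSpace.

Section GradedMap.
Variables (k : fieldType) (V W : lmodType k).
Variables (F : nat -> submodClosed V) (G : nat -> submodClosed W).
Hypothesis Finc : forall n, {subset F n <= F n.+1}.
Hypothesis Ginc : forall n, {subset G n <= G n.+1}.

(** The leading term of degree n, by a formula linear in t and free of any decomposition. It is
    meaningful on [filt_tens F G n]; elsewhere it depends on the extensions chosen in [grpi]. *)
Definition symbol n (t : V ⊗ W) : gr F ⊗ gr G :=
  \sum_(i < n.+1) tmap (grpi F i) (grpi G (n - i)) t.

Lemma symbol_linear n : linear (symbol n).
Proof.
move=> a u v; rewrite /symbol scaler_sumr -big_split; apply: eq_bigr => i _.
exact: tmap_linear.
Qed.
HB.instance Definition _ n :=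
  GRing.isLinear.Build k _ _ _ (symbol n) (symbol_linear n).

(** Only the term of index i survives: a larger index kills v, a smaller one kills w. *)
Lemma symbol_ptens n i v w : v \in F i -> w \in G (n - i)%N -> (i <= n)%N ->
  symbol n (v ⊗ₚ w) = grpi F i v ⊗ₚ grpi G (n - i) w.
Proof.
move=> vF wG; rewrite -ltnS => i_n; rewrite /symbol (bigD1 (Ordinal i_n)) //=.
rewrite tmapE big1 ?addr0 // => j ji; rewrite tmapE.
have [ij|ij] := ltnP i j; first by rewrite (grpi_lt Finc vF ij) ptens0l.
have ji' : (j : nat) != i by apply: contraNneq ji => ji; apply/eqP/ord_inj.
by rewrite (grpi_lt Ginc wG) ?ptens0r //; lia.
Qed.

Lemma symbol_lt n m i v w : v \in F i -> w \in G (m - i)%N -> (i <= m)%N ->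
  (m < n)%N -> symbol n (v ⊗ₚ w) = 0.
Proof.
move=> vF wG im mn; rewrite /symbol big1 // => j _; rewrite tmapE.
have [ij|ji] := ltnP i j; first by rewrite (grpi_lt Finc vF ij) ptens0l.
by rewrite (grpi_lt Ginc wG) ?ptens0r //; lia.
Qed.

Lemma symbol_filt n (s : forall i : 'I_n.+1, seq (subsp (F i) * subsp (G (n -
  i)%N))) :
  symbol n (\sum_(i < n.+1) \sum_(p <- s i) val p.1 ⊗ₚ val p.2) =
  \sum_(i < n.+1) \sum_(p <- s i) gr_cls p.1 ⊗ₚ gr_cls p.2.
Proof.
rewrite linear_sum; apply: eq_bigr => i _.
rewrite linear_sum; apply: eq_bigr => p _ /=.
by rewrite (symbol_ptens (valP p.1) (valP p.2) (ltn_ord i)) !grpi_val.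
Qed.

Lemma symbol_filt_lt m n t : filt_tens F G m t -> (m < n)%N -> symbol n t = 0.
Proof.
move=> [s ->] mn; rewrite linear_sum big1 // => i _.
rewrite linear_sum big1 // => p _ /=.
exact: (symbol_lt (valP p.1) (valP p.2) (ltn_ord i) mn).
Qed.

(** The map demanded by [gr_map] exists because [symbol n \o r] vanishes on H_(n-1), hence descends
    to the graded piece, and [symbol_filt] computes it on every decomposition. *)
Lemma gr_mapE (U : lmodType k) (H : nat -> submodClosed U)
    (r : {linear U -> V ⊗ W}) :
  (forall n u, u \in H n -> filt_tens F G n (r u)) ->
  forall n u, u \in H n -> gr_map H F G r (grpi H n u) = symbol n (r u).
Proof.
move=> rH.
pose P (h : {linear gr H -> gr F ⊗ gr G}) := forall n (v : subsp (H n))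
  (s : forall i : 'I_n.+1, seq (subsp (F i) * subsp (G (n - i)%N))),
  r (val v) = \sum_(i < n.+1) \sum_(p <- s i) val p.1 ⊗ₚ val p.2 ->
  h (gr_cls v) = \sum_(i < n.+1) \sum_(p <- s i) gr_cls p.1 ⊗ₚ gr_cls p.2.
have /the_linearP : exists h, P h.
  have [[|n] v|h hE] := @gr_lift _ _ H _ (fun n => symbol n \o r).
  - by move=> /zerospP->; rewrite linear0.
  - by move=> /rH vn; rewrite /= (symbol_filt_lt vn).
  exists h => n v s vE; rewrite -symbol_filt -vE -grpi_val.
  exact: hE (valP v).
rewrite -/(gr_map H F G r) => PG n u uH; rewrite (grpi_cls uH).
have [s sE] := rH n u uH; rewrite (PG n (Subsp uH) s) // -symbol_filt.
by rewrite -sE.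
Qed.

End GradedMap.

(** * The coalgebra gr C and its comodules *)

Lemma sum_triangle (V : zmodType) (X : nat -> nat -> V) n :
  \sum_(j < n.+1) \sum_(l < (n - j).+1) X j l =
  \sum_(q < n.+1) \sum_(j < q.+1) X j (q - j)%N.
Proof.
elim: n => [|n IHn]; first by rewrite !big_ord_recl !big_ord0.
rewrite [RHS]big_ord_recr /= -IHn [LHS]big_ord_recr /= subnn.
rewrite [X in _ + X = _]big_ord_recl big_ord0 addr0.
rewrite [X in _ = _ + X]big_ord_recr /= subnn addrA -big_split.
congr (_ + _); apply: eq_bigr => j _ /=.
by rewrite subSn ?big_ord_recr // -ltnS.
Qed.

Lemma act_fun_sum (k : fieldType) (C : precoalg k) (M : precomod C) I (r : seq
  I)
    (f : {scalar C}) (g : I -> {scalar C}) (m : M) :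
  (forall c, f c = \sum_(i <- r) g i c) -> act f m = \sum_(i <- r) act (g i) m.
Proof.
move=> fE; apply/eqP; rewrite -subr_eq0; apply/eqP/scalar_sep => h.
rewrite linearB linear_sum -coef_eval fE -sumrB big1 // => i _ /=.
by rewrite coef_eval subrr.
Qed.

Section GradedComodule.
Variables (k : fieldType) (C : precoalg k).
Hypothesis HC : is_coalg C.

Notation K j := (ann (prevf (@coradf k C) j)).
Notation cpi := (grpi (@coradf k C)).

(** Common to the Loewy series of a comodule and to the coradical filtration of C, so that gr E and
    gr C are treated together, without comparing the two filtrations on C. *)
Definition filt_comod (M : precomod C) (F : nat -> submodClosed M) :=
  (forall n, {subset F n <= F n.+1}) /\
  (forall n j m f, m \in prevf F n -> K j f -> act f m \in prevf F (n - j)).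

Definition grc (M : precomod C) (F : nat -> submodClosed M) : precomod
  (gr_coalg C) :=
  @Precomod k (gr_coalg C) (gr F) (gr_map F F (@coradf k C) coact).

Lemma loewy_filt_comod (M : precomod C) : is_comod M -> filt_comod (@loewy k C
  M).
Proof.
move=> HM; split=> [n|n j m f]; first exact: loewy_inc.
exact: loewy_filt.
Qed.

Lemma regc_filt_comod : @filt_comod (regc C) (@coradf k C).
Proof.
by split=> [n|n j m f]; [exact: coradf_inc|exact: coradf_filt].
Qed.

Lemma cpi_ann j (f : {scalar gr_coalg C}) : K j (f \o cpi j).
Proof.
by move=> c cj /=; rewrite (grpi_prev (coradf_inc HC) cj) linear0.
Qed.

Section Action.
Variables (M : precomod C) (F : nat -> submodClosed M).
Hypothesis HF : filt_comod F.

Lemma filt_act n j m f : (j <= n)%N -> m \in F n -> K j f ->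
  act f m \in F (n - j)%N.
Proof.
by move=> jn mF fK; have := HF.2 n.+1 j m f mF fK; rewrite subSn.
Qed.

(** If f - g kills C_q, it sends F_n into F_(n-q-1), which is invisible in degree n - q. So
    functionals on C need to be known only on C_q, where the arbitrary extension in [grpi] does not
    matter. *)
Lemma grpi_act_eq n q (f g : {scalar C}) m : (q <= n)%N -> m \in F n ->
  (forall c, c \in coradf C q -> f c = g c) ->
  grpi F (n - q) (act f m) = grpi F (n - q) (act g m).
Proof.
move=> qn mF fg; apply/eqP; rewrite -subr_eq0 -linearB; apply/eqP.
rewrite /act -(@rconB _ _ _ f g (f \- g)) //; apply: (grpi_prev HF.1).
have := HF.2 n.+1 q.+1 m (f \- g) mF; rewrite subSS; apply => c cq /=.
by rewrite fg // subrr.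
Qed.

(** The component of f in degree j, read on C as [f \o cpi j], kills C_(j-1) and lowers the degree
    by j. *)
Lemma gr_act (f : {scalar gr_coalg C}) n m : m \in F n ->
  @act _ _ (grc F) f (grpi F n m) =
  \sum_(j < n.+1) grpi F (n - j) (act (f \o cpi j) m).
Proof.
move=> mF; rewrite actE /= (gr_mapE HF.1 (coradf_inc HC)) //; last first.
  move=> n' u uF; apply: (filt_tensP (coradf_inc HC)) => j g gK.
  exact: (HF.2 n'.+1 j u g uF gK).
rewrite linear_sum (reindex_inj rev_ord_inj); apply: eq_bigr => i _ /=.
rewrite rcon_tmap subSS subKn; first by [].
by rewrite -ltnS.
Qed.

End Action.

Lemma gr_counitE n c : c \in coradf C n ->
  @counit _ (gr_coalg C) (cpi n c) = if n == 0%N then counit c else 0.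
Proof.
move=> cn.
pose P (e : {linear gr (@coradf k C) -> k^o}) :=
  forall n (c : subsp (coradf C n)),
    e (gr_cls c) = if n == 0%N then counit (val c) else 0.
have PG : P (the_linear P); first apply: the_linearP.
  pose h n : {linear C -> k^o} := if n == 0%N then counit else \0.
  have [[|m] v //|e eE] := @gr_lift _ _ (@coradf k C) _ h.
    by move=> /zerospP->; rewrite linear0.
  exists e => m v; rewrite -grpi_val (eE _ _ (valP v)) /h.
  by case: eqP.
exact: etrans (congr1 _ (grpi_cls cn)) (PG n (Subsp cn)).
Qed.

Lemma conv_cpi (f g : {scalar gr_coalg C}) q c : c \in coradf C q ->
  conv f g (cpi q c) = \sum_(j < q.+1) conv (f \o cpi (q - j)) (g \o cpi j) c.
Proof.
move=> cq; rewrite convE.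
have -> : cact g (cpi q c) = \sum_(j < q.+1) cpi (q - j) (cact (g \o cpi j) c).
  exact: (gr_act regc_filt_comod).
by rewrite linear_sum.
Qed.

Lemma act_zero (M : precomod C) (m : M) : act \0 m = 0.
Proof. by apply: scalar_sep => h; rewrite -coef_eval. Qed.

(** Two uses of [gr_act] give a sum over pairs (j, l), regrouped by q = j + l. The degree q
    component of a convolution equals the sum of the convolutions of components on C_q only
    ([conv_cpi]), which is enough by [grpi_act_eq]. *)
Lemma grc_comod (M : precomod C) (F : nat -> submodClosed M) :
  is_comod M -> filt_comod F -> is_comod (grc F).
Proof.
move=> HM HF; have [actA act1] := (comodP M).1 HM.
apply/comodP; split=> [f g x|x].
  pose L : {linear grc F -> grc F} := actl _ f \o actl _ g.
  suff E : L =1 actl _ (conv f g) by exact: E x.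
  apply: (@gr_lin_eq _ _ F (grc F)) => n m mF.
  rewrite /L /= (gr_act HF) // linear_sum.
  pose X j l := grpi F (n - j - l) (act (f \o cpi l) (act (g \o cpi j) m)).
  transitivity (\sum_(j < n.+1) \sum_(l < (n - j).+1) X j l).
    apply: eq_bigr => j _ /=; rewrite (gr_act HF) //.
    apply: (filt_act HF) => //; [by rewrite -ltnS|exact: cpi_ann].
  rewrite sum_triangle [RHS](gr_act HF) //; apply: eq_bigr => q _.
  have [h hE] : exists h : {scalar C}, forall c,
      h c = \sum_(j < q.+1) conv (f \o cpi (q - j)) (g \o cpi j) c.
    have [|h hE] := @ex_scalar _ _ (fun c =>
      \sum_(j < q.+1) conv (f \o cpi (q - j)) (g \o cpi j) c); last by exists h.
    move=> a u v; rewrite mulr_sumr -big_split; apply: eq_bigr => j _.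
    exact: linearP.
  have qn : (q <= n)%N by rewrite -ltnS.
  rewrite (grpi_act_eq HF (g := h) qn mF); last first.
    by move=> c cq; rewrite hE -conv_cpi.
  rewrite (act_fun_sum _ hE) linear_sum; apply: eq_bigr => j _.
  rewrite /X actA; congr (grpi F _ _).
  by have := ltn_ord j; lia.
suff E : actl (grc F) counit =1 idfun by exact: E x.
apply: (@gr_lin_eq _ _ F (grc F)) => n m mF.
rewrite /= (gr_act HF) // big_ord_recl big1 ?addr0 => [|j _].
  rewrite (grpi_act_eq HF (g := counit)) ?act1 ?subn0 // => c cq.
  exact: (gr_counitE cq).
rewrite (grpi_act_eq HF (g := \0)) ?act_zero ?linear0 ?ltn_ord // => c cq.
exact: (gr_counitE cq).
Qed.

(** As a comodule over itself, gr C is by conversion [grc] of the coradical filtration: this settles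
    all but one counit law. There only the term j = n contributes, the counit of gr C being zero in
    positive degree. *)
Lemma gr_coalg_coalg : is_coalg (gr_coalg C).
Proof.
have [H1 H2] := (comodP _).1 (grc_comod (regc_comod HC) regc_filt_comod).
have [cA cL c1] := (coalgP C).1 HC.
apply/coalgP; split=> [|f x|]; [exact: H1| |exact: H2].
pose L : {linear gr (@coradf k C) -> k^o} := counit \o (cact f : {linear
  gr_coalg C -> gr_coalg C}).
suff E : L =1 f by exact: E x.
apply: (@gr_lin_eq _ _ (@coradf k C) k^o) => n c cn.
have E : cact f (cpi n c) = \sum_(j < n.+1) cpi (n - j) (cact (f \o cpi j) c).
  exact: (gr_act regc_filt_comod).
rewrite /L /= E linear_sum big_ord_recr /= big1 ?add0r => [|j _]; last first.
  rewrite gr_counitE; last first.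
    by apply: (filt_act regc_filt_comod) => //; [rewrite ltnW|exact: cpi_ann].
  by rewrite subn_eq0 leqNgt ltn_ord.
have c0 : cact (f \o cpi n) c \in coradf C (n - n).
  by apply: (filt_act regc_filt_comod) => //; exact: cpi_ann.
by rewrite subnn in c0 *; rewrite (gr_counitE c0) cL.
Qed.

Lemma ex_gr_hom (M N : precomod C) (F : nat -> submodClosed M)
    (G : nat -> submodClosed N) (u : {linear M -> N}) :
  filt_comod F -> filt_comod G -> is_hom u ->
  (forall n m, m \in F n -> u m \in G n) ->
  exists2 v : {linear grc F -> grc G}, is_hom v &
    forall n m, m \in F n -> v (grpi F n m) = grpi G n (u m).
Proof.
move=> HF HG /homP Hu uFG.
have [[|n] m mF|v vE] := @gr_lift _ _ F (grc G) (fun n => grpi G n \o u).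
- by move: mF => /zerospP ->; rewrite linear0.
- by apply: (grpi_prev HG.1); apply: uFG.
exists v => //; apply/homP => f x.
pose L1 : {linear grc F -> grc G} := v \o actl (grc F) f.
pose L2 : {linear grc F -> grc G} := actl (grc G) f \o v.
suff E : L1 =1 L2 by exact: (E x).
apply: (@gr_lin_eq _ _ F _ L1 L2) => n m mF.
rewrite /L1 /L2 /= vE //= (gr_act HF) // (gr_act HG) ?uFG // linear_sum.
apply: eq_bigr => j _; rewrite vE /= ?Hu //.
by apply: (filt_act HF) => //; [rewrite -ltnS|exact: cpi_ann].
Qed.

End GradedComodule.

(** * Injective envelopes *)

Section Injectives.
Variables (k : fieldType) (C : precoalg k).

Lemma is_hom_comp (M N P : precomod C) (f : {linear M -> N}) (g : {linear N ->
  P}) :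
  is_hom f -> is_hom g -> is_hom (g \o f).
Proof. by move=> /homP Hf /homP Hg; apply/homP => h m /=; rewrite Hf Hg. Qed.

Lemma is_hom_id (M : precomod C) : is_hom (idfun : {linear M -> M}).
Proof. by apply/homP. Qed.

Lemma hom_inj_comod (M N : precomod C) (f : {linear M -> N}) :
  is_comod N -> is_hom f -> injective f -> is_comod M.
Proof.
move=> /comodP[actA act1] /homP Hf f_inj; apply/comodP; split=> [g h m|m].
  by apply: f_inj; rewrite !Hf actA.
by apply: f_inj; rewrite Hf act1.
Qed.

Lemma hom_ker_stable (M N : precomod C) (f : {linear M -> N}) :
  is_hom f -> stable (actl M) (preimsp f (zerosp N)).
Proof.
move=> /homP Hf g m; rewrite !preimspP => /zerospP fm.
by apply/zerospP; rewrite /= Hf fm linear0.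
Qed.

(** Homomorphisms M -> C correspond to functionals on M by composition with the counit, with inverse
    [coef]; so extending a homomorphism amounts to extending a functional. *)
Lemma regc_injective : is_coalg C -> injective_comod (regc C).
Proof.
move=> HC; have HR := regc_comod HC; have [cA cL _] := (coalgP C).1 HC.
split=> // M N i f HM HN /homP Hi i_inj /homP Hf.
have [g gE] := scalar_ext (counit \o f) i_inj.
exists (coef g); first by apply/homP => h n; rewrite /= -coef_act.
move=> m; apply/eqP; rewrite -subr_eq0; apply/eqP/scalar_sep => h.
rewrite linearB /= coef_eval -Hi gE /= Hf.
have -> : counit (act h (f m : regc C)) = h (f m) by apply: cL.
by rewrite subrr.
Qed.

Lemma retract_injective (I J : precomod C) (u : {linear J -> I}) (p : {linear I
  -> J}) :
  injective_comod I -> is_hom u -> is_hom p -> (forall x, p (u x) = x) ->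
  injective_comod J.
Proof.
move=> [HI Iinj] Hu Hp pK; have u_inj : injective u := can_inj pK.
split=> [|M N i f HM HN Hi i_inj Hf]; first exact: hom_inj_comod Hu u_inj.
have [g Hg gE] := Iinj M N i (u \o f) HM HN Hi i_inj (is_hom_comp Hf Hu).
exists (p \o g); first exact: is_hom_comp.
by move=> m; rewrite /= gE /= pK.
Qed.

Lemma essential_inj (S E N : precomod C) (i : {linear S -> E}) (f : {linear E
  -> N}) :
  (forall X : submodClosed E, is_subcomod X -> (exists2 x, x \in X & x != 0) ->
    exists2 s, i s \in X & s != 0) ->
  is_hom f -> (forall s, f (i s) = 0 -> s = 0) -> injective f.
Proof.
move=> ess Hf fi0 x y fxy; apply/eqP; rewrite -subr_eq0;
  apply: contrapT => /negP xy.
have [||s] := ess (preimsp f (zerosp N)).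
- exact/subcomodP/hom_ker_stable.
- by exists (x - y) => //; rewrite preimspP; apply/zerospP;
  rewrite linearB fxy subrr.
by rewrite preimspP => /zerospP/fi0 ->; rewrite eqxx.
Qed.

(** The extension f of j is injective since i is essential, hence has a retraction g. As g is
    injective on j S and j is essential, g is injective too, which makes f surjective. *)
Lemma injective_envelope_unique (S E F : precomod C) (i : {linear S -> E})
    (j : {linear S -> F}) :
  injective_envelope i -> injective_envelope j -> comod_iso E F.
Proof.
move=> [Einj Hi i_inj iess] [Finj Hj j_inj jess].
have [HE Eext] := Einj; have [HF Fext] := Finj.
have HS := hom_inj_comod HE Hi i_inj.
have [f Hf fE] := Fext _ _ i j HS HE Hi i_inj Hj.
have f_inj : injective f.
  by apply: (essential_inj iess) => // s; rewrite fE -[0](linear0 j) => /j_inj.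
have [g Hg gE] := Eext _ _ f idfun HE HF Hf f_inj (@is_hom_id E).
have g_inj : injective g.
  by apply: (essential_inj jess) => // s;
    rewrite -fE gE -[0](linear0 i) => /i_inj.
exists f => //; exists g; first exact: gE.
by move=> y; apply: g_inj; rewrite gE.
Qed.

End Injectives.

Section Degree0.
Variables (k : fieldType) (C : precoalg k) (S : precomod C).
Hypothesis S0 : forall f (x : S), ann (coradical C) f -> act f x = 0.

Notation cpi := (grpi (@coradf k C)).

(** The specification of [deg0_comod] constrains the coaction at x only through decompositions in S
    ⊗ C_0; the hypothesis on S provides one. *)
Lemma deg0_act (f : {scalar gr_coalg C}) (x : S) :
  @act _ _ (deg0_comod S) f x = act (f \o cpi 0) x.
Proof.
pose P (r : {linear S -> S ⊗ gr (@coradf k C)}) :=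
  forall (x : S) (s : seq (S * subsp (coradf C 0))),
    coact x = \sum_(p <- s) p.1 ⊗ₚ val p.2 -> r x = \sum_(p <- s) p.1 ⊗ₚ gr_cls
      p.2.
have PT : P (tmap idfun (cpi 0) \o coact).
  move=> y s yE; rewrite /= yE linear_sum; apply: eq_bigr => p _ /=.
  by rewrite tmapE grpi_val.
have PD : P (the_linear P) by apply: the_linearP;
  exists (tmap idfun (cpi 0) \o coact).
have [s sE] : exists s : seq (S * subsp (coradf C 0)),
    coact x = \sum_(p <- s) p.1 ⊗ₚ val p.2.
  have: coact x \in tsub (predT : {pred S}) (coradf C 0).
    apply/tsubTrP => g; apply/annihP => h hC.
    by rewrite -rcon_lcon -actE S0 ?linear0.
  move=> /span_sum[a _ [v [w [_ wB ->]]]|r rP ->].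
    by exists (a *: v), w; rewrite ptensZl.
  elim: r rP => [|u r IHr] rP; first by exists [::]; rewrite !big_nil.
  have [|s sE] := IHr; first by move=> y yr; apply: rP; rewrite inE yr orbT.
  have [v [w [_ wB uE]]] := rP u (mem_head _ _).
  by exists ((v, Subsp wB) :: s); rewrite !big_cons sE -uE.
have -> : @act _ _ (deg0_comod S) f x = rcon f (the_linear P x) by [].
by rewrite (PD x s sE) -(PT x s sE) [LHS](rcon_tmapr (cpi 0)).
Qed.

End Degree0.

(** * The graded comodule of the injective envelope of a simple comodule *)

Section Envelope.
Variables (k : fieldType) (C : precoalg k) (S E : precomod C) (i : {linear S ->
  E}).
Hypotheses (HC : is_coalg C) (HS : is_comod S) (simS : simple_comod S).
Hypothesis iE : injective_envelope i.

Let HE : is_comod E. Proof. by have [[]] := iE. Qed.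
Let Hi : is_hom i. Proof. by have [] := iE. Qed.
Let i_inj : injective i. Proof. by have [] := iE. Qed.

Notation epi := (grpi (@loewy k C E)).
Notation cpi := (grpi (@coradf k C)).

Lemma simple_comod_act0 f (x : S) : ann (coradical C) f -> act f x = 0.
Proof.
move=> fC; apply: ((socleP HC HS x).1 _ f fC).
have [[y y0] Smin] := simS.
pose T : submodClosed S := span (fun=> True).
have T1 z : z \in T by apply: mem_span.
apply: (@mem_sumsp _ _ _ T) (T1 x); split=> [|| N sN _].
- by apply/subcomodP => g z _.
- by exists y.
- by have [N0|N1] := Smin N sN; [left|right=> z _].
Qed.

(** Essentiality makes every simple subcomodule of E meet i S, hence lie in it. *)
Lemma socle_envelope x : x \in socle E -> exists s, x = i s.
Proof.
pose I := imsp i (span (fun=> True)).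
suff H : {subset socle E <= I} by move=> /H/imspP[s _ ->]; exists s.
have sI : stable (actl E) I.
  move=> f _ /imspP[s _ ->]; apply/imspP; exists (act f s);
    first exact: mem_span.
  by rewrite /= ((homP _).1 Hi).
apply: span_sub => {}x [N /[dup] [[sN N0 _]] /simple_subcomodP simN xN].
have [NI0|] := simple_meet simN sI; last by apply.
have [_ _ _ ess] := iE; have [s sN' /eqP[]] := ess N sN N0.
by apply: i_inj; rewrite linear0; apply: NI0 => //; apply/imspP;
  exists s => //; apply: mem_span.
Qed.

(** Take f with f (i y) = 1 for some y in S. The counit takes [coef f (i y)] to 1, so [coef f] is
    nonzero on i S; by simplicity it is injective there, by essentiality on E, and injectivity of E
    splits it. *)
Lemma ex_retract : exists (u : {linear E -> regc C}) (p : {linear regc C -> E}),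
  [/\ is_hom u, is_hom p & forall x, p (u x) = x].
Proof.
have [[_ Eext] _ _ ess] := iE.
have [[y y0] Smin] := simS.
have iy0 : i y != 0 by apply: contraNneq y0 => iy; apply/eqP/i_inj;
  rewrite iy linear0.
have [f fy] := ex_scalar1 iy0.
pose u : {linear E -> regc C} := coef f.
have Hu : is_hom u by apply/homP => g m; rewrite /u /= -coef_act.
have u_inj : injective u.
  apply: (essential_inj ess Hu) => s us.
  have [] := Smin (preimsp (u \o i) (zerosp _)).
  - by apply/subcomodP; apply: hom_ker_stable; apply: is_hom_comp.
  - by apply; rewrite preimspP; apply/zerospP.
  - move=> /(_ y); rewrite preimspP => /zerospP/(congr1 counit).
    rewrite /= /u /= coef_eval linear0 ((comodP _).1 HE).2 fy => /eqP.
    by rewrite oner_eq0.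
have [p Hp pE] := Eext _ _ u idfun HE (regc_comod HC) Hu u_inj (@is_hom_id _ _
  E).
by exists u, p.
Qed.

Lemma gr_envelope_injective : injective_comod (gr_comod E).
Proof.
have [u [p [Hu Hp pK]]] := ex_retract.
have FE := loewy_filt_comod HC HE; have FC := regc_filt_comod HC.
have uF n m : m \in loewy E n -> u m \in coradf C n.
  move=> /(loewyP HC HE) mn; apply/annihP => f fC.
  have [_ _ c1] := (coalgP C).1 HC.
  (* Writing f as counit of f.(-) lets the homomorphism u carry f over to m, where it acts as
     zero. *)
  have -> : f (u m) = counit (cact f (u m)) by have [_ -> _] := (coalgP C).1 HC.
  have -> : cact f (u m) = u (act f m) by rewrite ((homP _).1 Hu).
  by rewrite mn // !linear0.
have pF n c : c \in coradf C n -> p c \in loewy E n.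
  move=> cn; apply/(loewyP HC HE) => f fC; rewrite -((homP _).1 Hp).
  have -> : act f (c : regc C) = 0; last by rewrite linear0.
  apply/zerospP; have := FC.2 n.+1 n.+1 c f cn fC; by rewrite subnn.
have [U HU UE] := ex_gr_hom HC FE FC Hu uF.
have [P HP PE] := ex_gr_hom HC FC FE Hp pF.
apply: (retract_injective (I := regc (gr_coalg C)) (u := U) (p := P)) => //.
  exact/regc_injective/gr_coalg_coalg.
move=> x; suff E1 : P \o U =1 (idfun : {linear gr_comod E -> gr_comod E}) by
  exact: E1 x.
apply: gr_lin_eq => n m mF; rewrite /= UE // [LHS]PE ?pK //; exact: uF.
Qed.

Lemma gr_envelope_essential (N : submodClosed (gr_comod E)) :
  is_subcomod N -> (exists2 x, x \in N & x != 0) ->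
  exists2 s, epi 0 (i s) \in N & s != 0.
Proof.
move=> /subcomodP sN [x xN x0].
have FE := loewy_filt_comod HC HE; have FC := regc_filt_comod HC.
(* N is not assumed to be graded, so x is a sum of components; n is its top degree, and a functional
   of degree n will see no lower component. *)
have [n [v [vF xE]]] : exists n (v : nat -> E), (forall i, v i \in loewy E i) /\
    (x = \sum_(i < n.+1) epi i (v i) /\ epi n (v n) != 0).
  have [n [v [vF xE]]] := gr_sum x; elim: n xE => [|n IHn] xE.
    by case/eqP: x0; rewrite xE big_ord0.
  have [v0|v0] := eqVneq (epi n (v n)) 0; last by exists n, v.
  by apply: IHn; rewrite xE big_ord_recr /= v0 addr0.
case: xE => xE vn0.
have [f [fK fv]] : exists f, ann (prevf (@coradf k C) n) f /\ act f (v n) <> 0.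
  apply: contrapT => H; case/eqP: vn0; apply/grpi_eq0 => //.
  apply/(prevf_loewyP HC _ _ HE) => f fK; apply: contrapT => fv; apply: H.
  by exists f.
(* The functional on gr C that is f in degree n and zero in all others; it descends because f kills
   C_(n-1). *)
pose h j : {scalar C} := if j == n then f else \0.
have [j c|F FE'] := @gr_lift _ _ (@coradf k C) k^o h.
  by rewrite /h; case: eqP => // -> /fK.
have FhE j c : c \in coradf C j -> F (cpi j c) = if j == n then f c else 0.
  by move=> cj; rewrite FE' // /h; case: eqP.
have fvS : act f (v n) \in loewy E 0 by rewrite -(subnn n);
  apply: (filt_act FE).
have [s sE] := socle_envelope fvS.
exists s; last by apply/eqP => s0; apply: fv; rewrite sE s0 linear0.
rewrite -sE -(subnn n).
suff <- : @act _ _ (gr_comod E) F x = epi (n - n) (act f (v n)) by apply: (sN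
  F).
rewrite xE linear_sum big_ord_recr /= big1 => [|j _]; last first.
  rewrite [LHS](gr_act HC FE) // big1 // => l _.
  rewrite (grpi_act_eq FE (g := \0)) ?act_zero ?linear0 //.
    by rewrite -ltnS.
  move=> c cl /=; rewrite FhE // ifN // neq_ltn.
  by rewrite (leq_trans (ltn_ord l) (ltn_ord j)).
rewrite [X in _ + X](gr_act HC FE) // big_ord_recr /= big1 => [|j _];
  last first.
  rewrite (grpi_act_eq FE (g := \0)) ?act_zero ?linear0 ?(ltnW (ltn_ord j)) //.
  by move=> c cl /=; rewrite FhE // ifN // neq_ltn ltn_ord.
rewrite !add0r; apply: (grpi_act_eq FE) => // c cn /=.
by rewrite FhE // eqxx.
Qed.

Lemma gr_envelope : exists j : {linear deg0_comod S -> gr_comod E},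
  injective_envelope j.
Proof.
have FE := loewy_filt_comod HC HE.
pose j : {linear deg0_comod S -> gr_comod E} := epi 0 \o i.
have iS s : i s \in loewy E 0.
  by apply/(socleP HC HE) => f fC;
    rewrite -((homP _).1 Hi) simple_comod_act0 ?linear0.
exists j; split.
- exact: gr_envelope_injective.
- apply/homP => f s; rewrite (deg0_act simple_comod_act0) /j /=.
  by rewrite [RHS](gr_act HC FE) // big_ord_recl big_ord0 addr0 ((homP _).1 Hi).
- move=> s t; rewrite /j /= => /eqP; rewrite -subr_eq0 -!linearB => /eqP.
  move=> /(grpi_eq0 (iS _))/zerospP; rewrite -(linear0 i) => /i_inj/eqP.
  by rewrite subr_eq0 => /eqP.
- exact: gr_envelope_essential.
Qed.

End Envelope.

(** Existence is asserted along with the comparison so that the latter is not vacuous; gr E itself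
    is the witness. *)
Theorem theorem2p3 (k : fieldType) (C : precoalg k) (S E : precomod C)
    (i : {linear S -> E}) :
  is_coalg C -> is_comod S -> simple_comod S -> injective_envelope i ->
  (exists (F : precomod (gr_coalg C)) (j : {linear deg0_comod S -> F}),
     injective_envelope j) /\
  (forall (F : precomod (gr_coalg C)) (j : {linear deg0_comod S -> F}),
     injective_envelope j -> comod_iso (gr_comod E) F).
Proof.
move=> HC HS simS iE; have [j jE] := gr_envelope HC HS simS iE.
split=> [|F j' jE']; first by exists (gr_comod E), j.
exact: injective_envelope_unique jE jE'.
Qed.
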